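(* For a Coxeter group $W$, if $(W,S)$ and $(W,S')$ are Coxeter systems with two-dimensional Davis-Vinberg complexes, i.e. $\dim\Sigma(W,S)=\dim\Sigma(W,S')=2$, then the Coxeter diagrams of $(W,S)$ and $(W,S')$ have the same number of vertices, the same number of edges and the same multiset of edge-labels.
   Context: A Coxeter system $(W,S)$ consists of a group $W$ (a Coxeter group) and a finite generating set $S\subset W$ such that $W$ has the presentation $\langle S \mid (st)^{m(s,t)}=1 \text{ for } s,t\in S\rangle$, where $m:S\times S\to\mathbb{N}\cup\{\infty\}$ satisfies $m(s,t)=m(t,s)$, $m(s,s)=1$, and $m(s,t)\ge 2$ for $s\ne t$ (there is no relation when $m(s,t)=\infty$). Then $m(s,t)$ is the order of $st$ in $W$. The Coxeter diagram of $(W,S)$ is the undirected graph with vertex set $S$ in which two distinct vertices $s,t$ are joined by an edge if and only if $m(s,t)<\infty$, this edge being labeled by the integer $m(s,t)\ge 2$ (so edges labeled $2$ are drawn, and a missing edge means $m(s,t)=\infty$). A multiset is a collection in which order does not matter but multiplicities do. For $T\subset S$, $W_T$ denotes the subgroup of $W$ generated by $T$; $T$ is spherical if $W_T$ is finite. The Davis-Vinberg complex $\Sigma(W,S)$ is the geometric realization of the set of all left cosets $wW_T$ ($w\in W$, $T\subset S$ spherical) partially ordered by inclusion; its dimension is $\dim\Sigma(W,S)=\max\{|T| : T \text{ is a spherical subset of } S\}$. *)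

(* Defs.v *)
From HB Require Import structures.
From mathcomp Require Import all_boot.
From mathcomp Require Import finmap multiset.
From mathcomp Require Import classical_sets cardinality.

Set Implicit Arguments.
Unset Strict Implicit.
Unset Printing Implicit Defensive.

Local Open Scope classical_set_scope.
Local Open Scope fset_scope.
Local Open Scope group_scope.

(* Words over X and formal inverses: (x, false) stands for x and (x, true)
   for x^-1. *)
Definition word (X : Type) := seq (X * bool).

Definition word_eval (X : Type) (W : groupType) (g : X -> W) (w : word X) : W :=
  \big[*%g/1]_(a <- w) (if a.2 then (g a.1)^-1 else g a.1).

(* The classes of this congruence form the quotient of the free group on X by
   the normal closure of R. *)
Inductive word_equiv (X : Type) (R : set (word X)) : word X -> word X -> Prop :=
| word_equiv_refl u : word_equiv R u u
| word_equiv_sym u v : word_equiv R u v -> word_equiv R v u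
| word_equiv_trans u v w :
    word_equiv R u v -> word_equiv R v w -> word_equiv R u w
| word_equiv_cancel u v x b :
    word_equiv R (u ++ [:: (x, b); (x, ~~ b)] ++ v) (u ++ v)
| word_equiv_relator u v r : R r -> word_equiv R (u ++ r ++ v) (u ++ v).

Definition has_presentation (X : Type) (W : groupType) (g : X -> W)
    (R : set (word X)) : Prop :=
  (forall y : W, exists w : word X, word_eval g w = y) /\
  (forall w : word X, word_eval g w = 1 <-> word_equiv R w [::]).

(* None encodes the value oo. *)
Definition coxeter_matrix (X : Type) (m : X -> X -> option nat) : Prop :=
  [/\ forall s t, m s t = m t s,
      forall s, m s s = Some 1%N
    & forall s t n, s <> t -> m s t = Some n -> (2 <= n)%N].

Definition coxeter_relators (X : Type) (m : X -> X -> option nat) :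
    set (word X) :=
  [set r | exists s t n, m s t = Some n /\
     r = flatten (nseq n [:: (s, false); (t, false)])].

Definition coxeter_system (W : groupType) (S : {fset W})
    (m : S -> S -> option nat) : Prop :=
  coxeter_matrix m /\
  has_presentation (fun s : S => val s) (coxeter_relators m).

Definition coxeter_edges (X : finType) (m : X -> X -> option nat) :
    {set {set X}} :=
  [set [set p.1; p.2] | p : X * X & (p.1 != p.2) && (m p.1 p.2 != None)]%SET.

(* For symmetric m the value at an edge [set s; t] is m s t, whichever ordered
   pair is picked; the default 0 is never reached on edges. *)
Definition edge_label (X : finType) (m : X -> X -> option nat)
    (e : {set X}) : nat :=
  if [pick p : X * X | e == [set p.1; p.2]%SET] is Some p
  then odflt 0%N (m p.1 p.2) else 0%N.

Definition edge_labels (X : finType) (m : X -> X -> option nat) : multiset nat :=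
  seq_mset [seq edge_label m e | e <- enum (coxeter_edges m)].

Definition is_subgroup (W : groupType) (H : set W) : Prop :=
  [/\ H 1, forall x y, H x -> H y -> H (x * y) & forall x, H x -> H x^-1].

Definition generated (W : groupType) (T : set W) : set W :=
  smallest (@is_subgroup W) T.

Definition spherical (W : groupType) (T : {fset W}) : Prop :=
  finite_set (generated [set` T]).

Definition spherical_cosets (W : groupType) (S : {fset W}) : set (set W) :=
  [set C | exists (w : W) (T : {fset W}),
     [/\ (T `<=` S)%fset, spherical T
      & C = [set w * x | x in generated [set` T]]%classic]].

(* The simplices of the geometric realization of a set P of subsets of U,
   partially ordered by inclusion, are spanned by its nonempty finite chains. *)
Definition simplex (U : Type) (P : set (set U)) (c : {fset set U}) : Prop :=
  [/\ c != fset0,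
      forall A, A \in c -> P A
    & forall A B, A \in c -> B \in c ->
        (A `<=` B)%classic \/ (B `<=` A)%classic].

(* A chain with n.+1 elements spans an n-dimensional simplex. For the poset of
   spherical cosets the resulting dimension is the largest cardinality of a
   spherical subset of S. *)
Definition realization_dim (U : Type) (P : set (set U)) (n : nat) : Prop :=
  (exists2 c, simplex P c & #|` c| = n.+1) /\
  (forall c, simplex P c -> (#|` c| <= n.+1)%N).

Definition davis_vinberg_dim (W : groupType) (S : {fset W}) (n : nat) : Prop :=
  realization_dim (spherical_cosets S) n.

(* Main.v *)
Require Import Defs.
From HB Require Import structures.
From mathcomp Require Import all_boot all_order all_algebra.
From mathcomp Require Import finmap multiset.
From mathcomp Require Import ring lra zify.
From mathcomp Require Import boolp classical_sets cardinality.
From mathcomp Require Import Rstruct reals trigo.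

Set Implicit Arguments.
Unset Strict Implicit.
Unset Printing Implicit Defensive.

(* The geometric representation gives two facts. First, every finite subgroup
   of a Coxeter group is conjugate into a finite parabolic subgroup (averaging
   the height over the subgroup yields an invariant point of the Tits cone), and
   maximal finite parabolic subgroups are pairwise non-conjugate. In dimension 2
   the edges labelled n therefore correspond to the conjugacy classes of maximal
   finite subgroups of order 2n, which gives the multiset of edge labels.
   Second, let [W] act by conjugation on its set of involutions, and take
   cohomology of this action with coefficients in F_3. In dimension 2 the
   groupoid of elements carrying simple roots to simple roots is freely
   generated by one isomorphism s -> t for each odd edge and one involution at s
   for each even edge at s. Hence H^0 and H^1 are the kernel and cokernel of
   F_3^(vertices + even edges) -> F_3^(odd edges), [v |-> v t - v s] on an odd
   edge st; the even edges account for the central involutions of the dihedral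
   parabolic subgroups. So dim H^0 - dim H^1 = #vertices + #even - #odd depends
   on the group only, and so does the number of vertices. *)

Import Order.TTheory GRing.Theory Num.Theory.
Local Open Scope ring_scope.

(** The acting set is all involutions because reflections depend on the generators: in the Klein
    four-group, with generators a, b or a, ab, the element b is a reflection only for the first
    pair. The set of involutions depends on the group alone. The coefficients are chosen to ignore
    order 2. Besides a free part, the stabilizers are built from elements of order 2, and 2 is
    invertible in F_3, so only odd edges can contribute to H^1. Being finite, F_3 also allows
    dimensions to be compared by counting, through injections obtained by choice. Neither cohomology
    group is computed: the rank of the map drops out of the difference. Even and odd edges are
    already counted by the multiset of labels, so the difference leaves exactly the number of
    vertices. Every positivity argument rests on one computation: in the plane of two simple roots,
    alternating products act through Chebyshev coefficients at $2\cos(\pi/n)$, positive before the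
    $n$-th and zero there. The value 2 for an infinite label gives coefficients that never return to
    zero. *)

(* Opaque, so that unification never unfolds the structure of Stdlib's reals. *)
Fact Rf : realType. Proof. exact: Rdefinitions.R. Qed.

(* [kappa (m s t)] is [-2 B(alpha_s, alpha_t)] for the Tits form [B]; the
   diagonal value [Some 1] gives [-2]. *)
Definition kappa (o : option nat) : Rf := if o is Some n then 2 * cos (pi / n%:R) else 2.

(* [cheb (2 * cos t) k = sin (k * t) / sin t]. *)
Fixpoint cheb2 (a : Rf) (k : nat) : Rf * Rf :=
  if k is k'.+1 then let: (p, q) := cheb2 a k' in (q, a * q - p) else (0, 1).
Definition cheb a k := (cheb2 a k).1.

(** * Chebyshev coefficients and their values at the Coxeter weights *)

Lemma cheb0 a : cheb a 0 = 0. Proof. by []. Qed.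
Lemma cheb1 a : cheb a 1 = 1. Proof. by []. Qed.
Lemma chebSS a k : cheb a k.+2 = a * cheb a k.+1 - cheb a k.
Proof. by rewrite /cheb /=; case: (cheb2 a k). Qed.

(** The recurrence preserves the quadratic form $q^2-apq+p^2$. Together with [cheb a n = 0] and
    positivity this yields the value 1 at $n-1$. *)
Lemma cheb_inv a k :
  cheb a k.+1 ^+ 2 - a * cheb a k.+1 * cheb a k + cheb a k ^+ 2 = 1.
Proof.
elim: k => [|k IH]; first by rewrite cheb0 cheb1; ring.
by rewrite chebSS -IH; ring.
Qed.

Lemma cheb_2 k : cheb 2 k = k%:R.
Proof.
suff: cheb 2 k = k%:R /\ cheb 2 k.+1 = k.+1%:R by case.
elim: k => [|k [IH1 IH2]]; first by split; rewrite ?cheb0 ?cheb1.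
by split=> //; rewrite chebSS IH1 IH2 -!natr1; ring.
Qed.

Lemma cheb_cos (t : Rf) k : cheb (2 * cos t) k * sin t = sin (k%:R * t).
Proof.
suff: cheb (2 * cos t) k * sin t = sin (k%:R * t) /\
  cheb (2 * cos t) k.+1 * sin t = sin (k.+1%:R * t) by case.
elim: k => [|k [IH1 IH2]]; first by split; rewrite ?cheb0 ?cheb1 ?mul0r ?mul1r ?sin0.
split=> //; rewrite chebSS mulrBl IH1 -[_ * cheb _ _ * _]mulrA IH2.
have -> : k.+2%:R * t = k.+1%:R * t + t by rewrite -[in LHS]natr1; ring.
have -> : k%:R * t = k.+1%:R * t - t by rewrite -[in RHS]natr1; ring.
rewrite sinB sinD; ring.
Qed.

Lemma kappa1 : kappa (Some 1) = -2.
Proof. by rewrite /kappa divr1 cospi; ring. Qed.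

Section KappaSome.
Variables (n : nat) (n2 : (2 <= n)%N).

Let t : Rf := pi / n%:R.
Let ngt0 : (0 : Rf) < n%:R. Proof. by rewrite ltr0n (leq_trans _ n2). Qed.

Lemma sin_kappa_gt0 k : (0 < k < n)%N -> 0 < sin (k%:R * t).
Proof.
case/andP=> k0 kn; apply: sin_gt0_pi; apply/andP; split.
  by rewrite mulr_gt0 ?ltr0n // divr_gt0 ?pi_gt0.
by rewrite mulrA ltr_pdivrMr // mulrC ltr_pM2l ?pi_gt0 // ltr_nat.
Qed.

Lemma cheb_kappa_gt0 k : (0 < k < n)%N -> 0 < cheb (kappa (Some n)) k.
Proof.
move=> hk; have h1 : 0 < sin t by have := @sin_kappa_gt0 1; rewrite mul1r; apply.
by rewrite -(pmulr_lgt0 _ h1) cheb_cos sin_kappa_gt0.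
Qed.

Lemma cheb_kappa_n : cheb (kappa (Some n)) n = 0.
Proof.
have h1 : 0 < sin t by have := @sin_kappa_gt0 1; rewrite mul1r; apply.
apply: (mulIf (lt0r_neq0 h1)); rewrite mul0r cheb_cos -/t.
by rewrite /t mulrC divfK ?sinpi // lt0r_neq0.
Qed.

(** $4-\kappa^2$ is the Gram determinant of two simple roots: a finite label gives a positive
    definite plane. *)
Lemma kappa_lt2 : kappa (Some n) ^+ 2 < 4.
Proof.
have h1 : 0 < sin t by have := @sin_kappa_gt0 1; rewrite mul1r; apply.
have := cos2Dsin2 t; rewrite /kappa -/t; nra.
Qed.

Lemma cheb_kappa_pred : cheb (kappa (Some n)) n.-1 = 1.
Proof.
have := cheb_inv (kappa (Some n)) n.-1.
rewrite prednK ?(leq_trans _ n2) // cheb_kappa_n.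
have : 0 < cheb (kappa (Some n)) n.-1 by apply: cheb_kappa_gt0; lia.
nra.
Qed.

(** Shifting by [n] is a half turn. *)
Lemma cheb_kappa_addn k : cheb (kappa (Some n)) (n + k) = - cheb (kappa (Some n)) k.
Proof.
suff: cheb (kappa (Some n)) (n + k) = - cheb (kappa (Some n)) k /\
      cheb (kappa (Some n)) (n + k).+1 = - cheb (kappa (Some n)) k.+1 by case.
elim: k => [|k [IH1 IH2]].
  rewrite addn0 cheb_kappa_n cheb0 oppr0; split=> //.
  by rewrite -[in LHS](ltn_predK n2) chebSS (ltn_predK n2) cheb_kappa_n cheb_kappa_pred mulr0 sub0r.
by rewrite !addnS; split=> //; rewrite !chebSS IH1 IH2; ring.
Qed.

End KappaSome.

Local Open Scope group_scope.

(** * Words and length *)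

(** The generators form an abstract finite type mapped to the group, so that finite sums and sets
    over them are at hand. Injectivity of [gval] is not assumed; it follows from the representation
    in [gval_inj]. *)
Record coxsys := CoxSys {
  gen : finType;
  grp : groupType;
  gval : gen -> grp;
  cm : gen -> gen -> option nat;
  cm_matrix : coxeter_matrix cm;
  cm_pres : has_presentation gval (coxeter_relators cm) }.

Section Words.
Variable C : coxsys.
Local Notation X := (gen C).
Local Notation W := (grp C).
Local Notation g := (@gval C).
Local Notation m := (@cm C).
Implicit Types (s t u : X) (us vs : seq X) (x y : W).

Lemma cmC s t : m s t = m t s. Proof. by case: (cm_matrix C). Qed.
Lemma cm_diag s : m s s = Some 1%N. Proof. by case: (cm_matrix C). Qed.
Lemma cm_ge2 s t n : s != t -> m s t = Some n -> (2 <= n)%N.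
Proof. by move/eqP=> st; case: (cm_matrix C) => _ _; apply. Qed.

Definition wprod us : W := \prod_(s <- us) g s.

Lemma wprod_cons s us : wprod (s :: us) = g s * wprod us.
Proof. exact: big_cons. Qed.
Lemma wprod_nil : wprod [::] = 1. Proof. exact: big_nil. Qed.
Lemma wprod_cat us vs : wprod (us ++ vs) = wprod us * wprod vs.
Proof. exact: big_cat. Qed.
Lemma wprod1 s : wprod [:: s] = g s.
Proof. by rewrite /wprod big_seq1. Qed.
Lemma wprod_rcons us s : wprod (rcons us s) = wprod us * g s.
Proof. by rewrite -cats1 wprod_cat wprod1. Qed.

Lemma word_eval_pos us : word_eval g [seq (s, false) | s <- us] = wprod us.
Proof. by rewrite /word_eval big_map. Qed.

Lemma wprod_relator s t n : m s t = Some n -> wprod (flatten (nseq n [:: s; t])) = 1.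
Proof.
move=> mst; rewrite -word_eval_pos; apply/(proj2 (cm_pres C)).
set r := map _ _; rewrite -[r]cats0 -[r ++ _]cat0s.
apply: (@word_equiv_relator _ _ [::] [::]); exists s, t, n; split=> //.
by rewrite /r map_flatten map_nseq.
Qed.

Lemma gval2 s : g s * g s = 1.
Proof. by have := wprod_relator (cm_diag s); rewrite /= !wprod_cons wprod_nil mulg1. Qed.

Lemma gvalV s : (g s)^-1 = g s.
Proof. by rewrite -[LHS]mulg1 -(gval2 s) mulKg. Qed.

Lemma wprod_rev us : wprod (rev us) = (wprod us)^-1.
Proof.
elim: us => [|s us IH]; first by rewrite wprod_nil invg1.
by rewrite rev_cons wprod_rcons wprod_cons IH invgM gvalV.
Qed.

Lemma wprod_surj x : exists us, wprod us = x.
Proof.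
have [w <-] := proj1 (cm_pres C) x; exists [seq a.1 | a <- w].
rewrite /wprod big_map; apply: eq_bigr => a _.
by case: a => s [] //=; rewrite gvalV.
Qed.

Lemma size_ex x : exists n, `[< exists us, wprod us = x /\ size us = n >].
Proof. by have [us hu] := wprod_surj x; exists (size us); apply/asboolP; exists us. Qed.

Definition len x : nat := ex_minn (size_ex x).

Lemma len_word x : exists2 us, wprod us = x & size us = len x.
Proof. by rewrite /len; case: ex_minnP => n /asboolP [us []]; exists us. Qed.

Lemma len_le us : (len (wprod us) <= size us)%N.
Proof. by rewrite /len; case: ex_minnP => n _; apply; apply/asboolP; exists us. Qed.

Lemma len1 : len 1 = 0.
Proof. by apply/eqP; rewrite -leqn0 -wprod_nil len_le. Qed.

Lemma len_eq0 x : len x = 0 -> x = 1.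
Proof. by have [us <- <-] := len_word x => /size0nil ->; rewrite wprod_nil. Qed.

Lemma lenM x y : (len (x * y) <= len x + len y)%N.
Proof.
have [us <- <-] := len_word x; have [vs <- <-] := len_word y.
by rewrite -wprod_cat -size_cat len_le.
Qed.

Lemma len_gval s : (len (g s) <= 1)%N.
Proof. by rewrite -wprod1 len_le. Qed.

Lemma lenV x : len x^-1 = len x.
Proof.
suff le y : (len y^-1 <= len y)%N by apply/eqP; rewrite eqn_leq le -{1}[x]invgK le.
by have [us <- <-] := len_word y; rewrite -wprod_rev -size_rev len_le.
Qed.

Lemma len_last x : x != 1 -> exists s y, x = y * g s /\ len x = (len y).+1.
Proof.
have [us <- eus] := len_word x; case/lastP: us eus => [|us s].
  by rewrite wprod_nil eqxx.
rewrite size_rcons wprod_rcons => e _; exists s, (wprod us); split=> //.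
apply/eqP; rewrite eqn_leq; apply/andP; split.
  by rewrite (leq_trans (lenM _ _)) // -[in leqRHS]addn1 leq_add2l len_gval.
by rewrite -e ltnS len_le.
Qed.

(** * Actions defined by the presentation *)

Section Action.
Variables (V : Type) (sg : X -> V -> V).
Hypothesis sg_rel : forall s t n, m s t = Some n -> iter n (sg s \o sg t) =1 id.

Lemma sgK s : involutive (sg s).
Proof. exact: (sg_rel (cm_diag s)). Qed.

Let act (w : word X) v := foldr (fun a => sg a.1) v w.

Let act_cat w w' v : act (w ++ w') v = act w (act w' v).
Proof. by rewrite /act foldr_cat. Qed.

Let act_equiv w w' : word_equiv (coxeter_relators m) w w' -> act w =1 act w'.
Proof.
elim=> {w w'} //.
- by move=> u v _ IH x; rewrite IH.
- by move=> u v w _ IH1 _ IH2 x; rewrite IH1 IH2.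
- by move=> u v x b z; rewrite !act_cat /= sgK.
move=> u v r [s [t [n [mst ->]]]] z; rewrite !act_cat; congr (act u _).
rewrite -[RHS](sg_rel mst); elim: {mst}n => //= n IH.
by rewrite IH.
Qed.

(** The universal property of the presentation. The presentation only decides when a word is
    trivial, so equality of two products is tested on [rev us ++ vs], the generators being
    involutions. *)
Lemma wprod_act us vs v : wprod us = wprod vs -> foldr sg v us = foldr sg v vs.
Proof.
have act_pos ws z : foldr sg z ws = act [seq (s, false) | s <- ws] z.
  by elim: ws => //= a ws ->.
have rev_act ws z : foldr sg (foldr sg z (rev ws)) ws = z.
  elim: ws z => //= a ws IH z.
  by rewrite rev_cons foldr_rcons IH sgK.
move=> e; have: wprod (rev us ++ vs) = 1 by rewrite wprod_cat wprod_rev e mulVg.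
rewrite -word_eval_pos => /(proj2 (cm_pres C)) /act_equiv /(_ v).
by rewrite -act_pos foldr_cat /= => {1}<-; rewrite rev_act.
Qed.

End Action.

(** The sign homomorphism: each generator negates a boolean, and all relators have even length. *)
Lemma odd_wprod us vs : wprod us = wprod vs -> odd (size us) = odd (size vs).
Proof.
have h s t n : m s t = Some n -> iter n (negb \o negb) =1 id.
  by move=> _ b; elim: n => //= n ->; rewrite negbK.
move/(@wprod_act bool (fun=> negb) h us vs false).
have e ws : foldr (fun=> negb) false ws = odd (size ws) by elim: ws => //= _ ws ->.
by rewrite !e.
Qed.

Definition parity x := odd (len x).

Lemma parity_wprod us : parity (wprod us) = odd (size us).
Proof. by rewrite /parity; have [vs e <-] := len_word (wprod us); apply: odd_wprod. Qed.

Lemma parityM x y : parity (x * y) = parity x (+) parity y.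
Proof.
have [us <-] := wprod_surj x; have [vs <-] := wprod_surj y.
by rewrite -wprod_cat !parity_wprod size_cat oddD.
Qed.

Lemma parity_gval s : parity (g s) = true.
Proof. by rewrite -wprod1 parity_wprod. Qed.

Lemma parityV x : parity x^-1 = parity x.
Proof. by rewrite /parity lenV. Qed.

Lemma gval_neq1 s : g s != 1.
Proof.
by apply/eqP=> e; have := parity_gval s; rewrite e -wprod_nil parity_wprod.
Qed.

Lemma len_mulr x s :
  len (x * g s) = (len x).+1 \/ len x = (len (x * g s)).+1.
Proof.
have l1 := lenM x (g s); have l2 := lenM (x * g s) (g s).
rewrite -mulgA gval2 mulg1 in l2; have l3 := len_gval s.
have : parity (x * g s) != parity x by rewrite parityM parity_gval; case: (parity x).
rewrite /parity => /eqP; lia.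
Qed.

End Words.

(** * The geometric representation *)

Section Alternating.
Variable X : Type.
Implicit Types s t : X.

(* The alternating word with [k] letters ending in [s, t]; [altl] starts with
   [s, t]. *)
Fixpoint alt k s t : seq X := if k is k'.+1 then rcons (alt k' t s) t else [::].

Lemma size_alt k s t : size (alt k s t) = k.
Proof. by elim: k s t => //= k IH s t; rewrite size_rcons IH. Qed.

Fixpoint altl k s t : seq X := if k is k'.+1 then s :: altl k' t s else [::].

Lemma rev_alt k s t : rev (alt k s t) = altl k t s.
Proof. by elim: k s t => //= k IH s t; rewrite rev_rcons IH. Qed.

Lemma alt_cat k j s t :
  alt k s t ++ altl j s t = if odd j then alt (k + j) t s else alt (k + j) s t.
Proof.
elim: j k s t => [|j IH] k s t /=; first by rewrite cats0 addn0.
by rewrite -cat_rcons (IH k.+1 t s) addSnnS; case: (odd j).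
Qed.

Lemma altl_alt k s t : altl k s t = if odd k then alt k t s else alt k s t.
Proof. exact: (alt_cat 0). Qed.

Lemma alt_cons k s t : alt k.+1 s t = (if odd k then s else t) :: alt k s t.
Proof.
elim: k s t => // k IH s t.
rewrite -[alt k.+2 s t]/(rcons (alt k.+1 t s) t) IH.
by rewrite -[alt k.+1 s t]/(rcons (alt k t s) t) -rcons_cons /=; case: (odd k).
Qed.

Lemma alt_split j n s t : exists2 us, size us = j & alt (j + n) s t = us ++ alt n s t.
Proof.
elim: j => [|j [us e1 e2]]; first by exists [::].
by rewrite addSn alt_cons e2; eexists (_ :: us); rewrite /= ?e1.
Qed.

End Alternating.

Section Rep.
Variable C : coxsys.
Local Notation X := (gen C).
Local Notation W := (grp C).
Local Notation g := (@gval C).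
Local Notation m := (@cm C).
Implicit Types (s t u : X) (us vs : seq X) (x y : W).

Local Notation vec := {ffun X -> Rf^o}.
Implicit Types v w : vec.

Lemma vecD v w t : (v + w) t = ((v t : Rf) + (w t : Rf))%R :> Rf. Proof. by rewrite ffunE. Qed.
Lemma vecN v t : (- v) t = (- (v t : Rf))%R :> Rf. Proof. by rewrite ffunE. Qed.
Lemma vecZ (a : Rf) v t : (a *: v) t = (a * (v t : Rf))%R :> Rf. Proof. by rewrite ffunE. Qed.
Lemma vec0 t : (0 : vec) t = 0%R :> Rf. Proof. by rewrite ffunE. Qed.
Definition vecE := (vecD, vecN, vecZ, vec0).

Definition alpha s : vec := [ffun t => (t == s)%:R].
Definition cwt s t : Rf := kappa (m s t).
Definition phi s v : Rf := (- \sum_t cwt s t * v t)%R.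
Definition sigma s v : vec := v - phi s v *: alpha s.

Lemma alphaE s t : alpha s t = (t == s)%:R. Proof. by rewrite ffunE. Qed.

Lemma vec_sum v : v = \sum_s v s *: alpha s.
Proof.
apply/ffunP=> t; rewrite sum_ffunE.  rewrite (bigD1 t) //= big1 ?addr0.
  by rewrite vecZ alphaE eqxx mulr1.
by move=> s /negPf st; rewrite vecZ alphaE eq_sym st mulr0.
Qed.

Lemma cwtC s t : cwt s t = cwt t s. Proof. by rewrite /cwt cmC. Qed.
Lemma cwt_diag s : cwt s s = (-2)%R. Proof. by rewrite /cwt cm_diag kappa1. Qed.

Lemma phi_alpha s t : phi s (alpha t) = (- cwt s t)%R.
Proof.
rewrite /phi (bigD1 t) //= big1 ?addr0 ?alphaE ?eqxx ?mulr1 //.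
by move=> u /negPf ut; rewrite alphaE ut mulr0.
Qed.

Lemma phiP s (a : Rf) v w : phi s (a *: v + w) = (a * phi s v + phi s w)%R.
Proof.
rewrite /phi mulrN -opprD; congr (- _)%R; rewrite mulr_sumr -big_split /=.
by apply: eq_bigr => t _; rewrite !vecE; ring.
Qed.

Lemma sigma_linear s : linear (sigma s).
Proof.
move=> a v w; rewrite /sigma phiP; apply/ffunP=> t; rewrite !vecE; ring.
Qed.
HB.instance Definition _ s := GRing.isLinear.Build Rf vec vec _ (sigma s) (sigma_linear s).

Definition act us v : vec := foldr sigma v us.
Lemma act_linear us : linear (act us).
Proof. by move=> a v w; elim: us => //= s us ->; rewrite linearP. Qed.
HB.instance Definition _ us := GRing.isLinear.Build Rf vec vec _ (act us) (act_linear us).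

Lemma act_rcons us s v : act (rcons us s) v = act us (sigma s v).
Proof. by rewrite /act foldr_rcons. Qed.
Lemma act_cat us vs v : act (us ++ vs) v = act us (act vs v).
Proof. by rewrite /act foldr_cat. Qed.

Lemma sigma_alpha s t : sigma s (alpha t) = alpha t + cwt s t *: alpha s.
Proof. by rewrite /sigma phi_alpha scaleNr opprK. Qed.

Lemma sigma_alphas s : sigma s (alpha s) = - alpha s.
Proof. by rewrite sigma_alpha cwt_diag; apply/ffunP=> t; rewrite !vecE; ring. Qed.

(** Peeling off the last two letters expresses length $k+2$ through lengths $k+1$ and $k$ by the
    Chebyshev recurrence, hence the two-step induction. *)
Lemma act_alt k s t : s != t ->
  act (alt k s t) (alpha s) =
    cheb (cwt s t) k.+1 *: alpha (if odd k then t else s) +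
    cheb (cwt s t) k *: alpha (if odd k then s else t).
Proof.
pose F k := forall s t, s != t -> act (alt k s t) (alpha s) =
    cheb (cwt s t) k.+1 *: alpha (if odd k then t else s) +
    cheb (cwt s t) k *: alpha (if odd k then s else t).
suff H : F k /\ F k.+1 by apply: (proj1 H).
elim: k {s t} => [|k [IH1 IH2]].
  split=> s t st; rewrite /= ?chebSS cheb0 cheb1 ?mulr1 ?subr0 scale1r.
    by rewrite scale0r addr0.
  by rewrite sigma_alpha cwtC addrC.
split=> // s t st; rewrite -[alt k.+2 s t]/(rcons (alt k.+1 t s) t) act_rcons.
rewrite sigma_alpha linearD linearZ /= -/(alt k.+1 t s) IH2 1?eq_sym //.
rewrite act_rcons sigma_alphas linearN /= IH1 // (cwtC t s) [in RHS]chebSS.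
by apply/ffunP=> x; rewrite !vecE (chebSS _ k); case: (odd k) => /=; ring.
Qed.

Lemma iter_sigma n s t v : iter n (sigma s \o sigma t) v = act (alt n.*2 s t) v.
Proof. by elim: n v => // n IH v; rewrite iterSr IH /= !act_rcons. Qed.

(** The vector splits into a part in the plane of the two simple roots, where the coefficients have
    period $2n$, and an orthogonal part fixed by both reflections. *)
Lemma act_alt_relator n s t v : s != t -> m s t = Some n -> act (alt n.*2 s t) v = v.
Proof.
move=> st mst; have n2 := cm_ge2 st mst.
have a2 : (cwt s t ^+ 2 < 4)%R by rewrite /cwt mst kappa_lt2.
have d0 : (4 - cwt s t ^+ 2 != 0)%R by rewrite gt_eqF // subr_gt0.
(* [c] and [d] solve $\varphi_s(v-v_0)=\varphi_t(v-v_0)=0$ for $v_0=c\alpha_s+d\alpha_t$, a system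
   of determinant $4-\kappa^2$. *)
pose c := ((2 * phi s v + cwt s t * phi t v) / (4 - cwt s t ^+ 2))%R.
pose d := ((2 * phi t v + cwt s t * phi s v) / (4 - cwt s t ^+ 2))%R.
pose v0 := c *: alpha s + d *: alpha t.
have fixs : sigma s (v - v0) = v - v0.
  rewrite {1}/sigma.
  have -> : v - v0 = (-1) *: v0 + v by rewrite scaleN1r addrC.
  rewrite phiP phiP -[d *: _]addr0 phiP !phi_alpha cwt_diag.
  have -> : phi s 0 = 0%R by rewrite /phi big1 ?oppr0 // => t0 _; rewrite vec0 mulr0.
  set z := (X in X *: alpha s); have -> : z = 0%R by rewrite /z /c /d; field.
  by rewrite scale0r subr0.
have fixt : sigma t (v - v0) = v - v0.
  rewrite {1}/sigma.
  have -> : v - v0 = (-1) *: v0 + v by rewrite scaleN1r addrC.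
  rewrite phiP phiP -[d *: _]addr0 phiP !phi_alpha cwt_diag (cwtC t s).
  have -> : phi t 0 = 0%R by rewrite /phi big1 ?oppr0 // => t0 _; rewrite vec0 mulr0.
  set z := (X in X *: alpha t); have -> : z = 0%R by rewrite /z /c /d; field.
  by rewrite scale0r subr0.
have e1 : act (alt n.*2 s t) (v - v0) = v - v0.
  by rewrite -iter_sigma; elim: n {mst n2} => //= k ->; rewrite fixt fixs.
have hk k := cheb_kappa_addn n2 k; rewrite -mst -/(cwt s t) in hk.
have hn := cheb_kappa_n n2; rewrite -mst -/(cwt s t) in hn.
have hp := cheb_kappa_pred n2; rewrite -mst -/(cwt s t) in hp.
have h2 : cheb (cwt s t) n.*2 = 0%R by rewrite -addnn hk hn oppr0.
have h3 : cheb (cwt s t) n.*2.+1 = 1%R.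
  by rewrite -addnn -addnS hk -[n.+1]addn1 hk opprK cheb1.
have e2 : act (alt n.*2 s t) (alpha s) = alpha s.
  by rewrite act_alt // odd_double h2 h3 scale0r scale1r addr0.
have e3 : act (alt n.*2 s t) (alpha t) = alpha t.
  have -> : n.*2 = n.*2.-1.+1 by lia.
  rewrite /= act_rcons sigma_alphas linearN /= act_alt 1?eq_sym // (cwtC t s).
  have -> : n.*2.-1.+1 = n.*2 by lia.
  have -> : n.*2.-1 = (n + n.-1)%N by lia.
  have -> : odd (n + n.-1) by lia.
  by rewrite hk h2 hp scale0r add0r scaleN1r opprK.
have e4 : act (alt n.*2 s t) v0 = v0 by rewrite /v0 linearD !linearZ /= e2 e3.
by rewrite -[in LHS](subrK v0 v) linearD /= e1 e4 subrK.
Qed.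

Lemma sigma_rel s t n : m s t = Some n -> iter n (sigma s \o sigma t) =1 id.
Proof.
move=> mst v; have [st|st] := eqVneq s t; last by rewrite iter_sigma act_alt_relator.
move: mst; rewrite -st cm_diag => -[<-] /=; rewrite {2}/sigma linearB linearZ /=.
by rewrite sigma_alphas scalerN opprK /sigma subrK.
Qed.

End Rep.

(** * Length of elements and positivity of roots *)

Section Length.
Variable C : coxsys.
Local Notation X := (gen C).
Local Notation W := (grp C).
Local Notation g := (@gval C).
Local Notation m := (@cm C).
Local Notation vec := {ffun X -> Rf^o}.
Implicit Types (s t u : X) (us vs : seq X) (x y : W) (v w : vec).

Lemma wprod_alt_double n s t : wprod (alt n.*2 s t) = (g s * g t) ^+ n.
Proof.
elim: n => [|n IH]; first exact: wprod_nil.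
by rewrite /= !wprod_rcons IH expgSr mulgA.
Qed.

Lemma braid_order n s t : m s t = Some n -> (g s * g t) ^+ n = 1.
Proof.
move/wprod_relator => <-; elim: n => [|n IH]; first by rewrite /= wprod_nil.
by rewrite expgS IH /= !wprod_cons mulgA.
Qed.

Lemma wprod_altC n s t : m s t = Some n -> wprod (alt n s t) = wprod (alt n t s).
Proof.
move=> mst; apply/eqP; rewrite -[X in _ == X]invgK -mulg_eq1 -wprod_rev rev_alt -wprod_cat.
rewrite alt_cat addnn.
by case: ifP => _; rewrite wprod_alt_double (@braid_order n) // cmC.
Qed.

(* [y] is the shortest element of the coset of [x] modulo the subgroup generated
   by [s] and [t]. *)
Lemma alt_decomp x s t : s != t -> len (x * g s) = (len x).+1 ->
  exists y k, [/\ x = y * wprod (alt k s t), len x = (len y + k)%N,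
     len (y * g s) = (len y).+1 /\ len (y * g t) = (len y).+1,
     forall n, m s t = Some n -> (k < n)%N &
     (len (x * g t) < len x)%N -> (0 < k)%N].
Proof.
move=> st xs.
pose P k := `[< exists y, x = y * wprod (alt k s t) /\ len x = (len y + k)%N >].
have P0 : exists k, P k.
  by exists 0; apply/asboolP; exists x; rewrite wprod_nil mulg1 addn0.
have Pb k : P k -> (k <= len x)%N by move/asboolP => [y [_ ->]]; exact: leq_addl.
(* Maximality of [k] excludes the descent of [y] that would extend the suffix. The other letter
   starts the suffix, so a descent there would cancel and shorten [x]; for [k = 0] it is [s], an
   ascent by hypothesis. *)
case: (ex_maxnP P0 Pb) => k /asboolP [y [xE xl]] kmax; exists y, k.
have notP : ~~ P k.+1 by apply/negP=> /kmax; rewrite ltnn.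
have up_o : len (y * g (if odd k then s else t)) = (len y).+1.
  have [//|yo] := len_mulr y (if odd k then s else t).
  case/negP: notP; apply/asboolP; exists (y * g (if odd k then s else t)).
  by rewrite alt_cons wprod_cons -mulgA (mulgA (g _)) gval2 mul1g; split=> //; lia.
have up_f : len (y * g (if odd k then t else s)) = (len y).+1.
  case: k xE xl {kmax notP up_o} => [|k] xE xl.
    by rewrite [y](_ : y = x) // xE wprod_nil mulg1.
  have [//|yf] := len_mulr y (if odd k.+1 then t else s).
  have := lenM (y * g (if odd k.+1 then t else s)) (wprod (alt k s t)).
  have := len_le (alt k s t); rewrite size_alt.
  move: xE yf; rewrite alt_cons wprod_cons /= if_neg mulgA => <-; lia.
split=> //.
- by case: (odd k) up_o up_f.
(* If [n <= k], the braid relation makes the suffix end in [s], which would be a descent of [x]. *)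
- move=> n mst; rewrite ltnNge; apply/negP=> nk.
  have [us us_sz] := alt_split (k - n) n s t; rewrite subnK // => altE.
  have n0 : (0 < n)%N by have := cm_ge2 st mst; lia.
  have e : x * g s = y * wprod (us ++ alt n.-1 s t).
    rewrite xE altE !wprod_cat (wprod_altC mst) -{1}(prednK n0) /= wprod_rcons.
    by rewrite -!mulgA gval2 mulg1.
  move: xs; rewrite e; have := lenM y (wprod (us ++ alt n.-1 s t)).
  have := len_le (us ++ alt n.-1 s t); rewrite size_cat size_alt us_sz; lia.
- move=> xt; rewrite lt0n; apply/eqP=> k0; move: xE up_o.
  by rewrite k0 /= wprod_nil mulg1 => <-; lia.
Qed.

Lemma cwt_cheb_gt0 k s t : s != t -> (forall n, m s t = Some n -> (k < n)%N) ->
  (0 < k)%N -> (0 < cheb (cwt s t) k)%R.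
Proof.
rewrite /cwt; case mst: (m s t) => [n|] st kn k0; last by rewrite cheb_2 ltr0n.
by rewrite cheb_kappa_gt0 ?(cm_ge2 st mst) // k0 kn.
Qed.

Lemma cwt_cheb_ge0 k s t : s != t -> (forall n, m s t = Some n -> (k <= n)%N) ->
  (0 <= cheb (cwt s t) k)%R.
Proof.
move=> st kn; case: k kn => [|k] kn; first by rewrite cheb0.
have [mst|] := eqVneq (m s t) (Some k.+1).
  by rewrite /cwt mst cheb_kappa_n // (cm_ge2 st mst).
move/eqP=> mst; apply/ltW/cwt_cheb_gt0 => // n mn.
by rewrite ltn_neqAle kn // andbT; apply/eqP=> e; rewrite e in mst.
Qed.

Definition rho x v : vec := act (sval (cid (wprod_surj x))) v.

Lemma rho_wprod us v : rho (wprod us) v = act us v.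
Proof. by rewrite /rho; case: cid => vs /= e; apply: wprod_act e; exact: sigma_rel. Qed.

Lemma rho_linear x : linear (rho x).
Proof. by move=> a v w; rewrite /rho linearP. Qed.
HB.instance Definition _ x := GRing.isLinear.Build Rf vec vec _ (rho x) (rho_linear x).

Lemma rho1 v : rho 1 v = v. Proof. by rewrite -wprod_nil rho_wprod. Qed.
Lemma rho_gval s v : rho (g s) v = sigma s v.
Proof. by rewrite -wprod1 rho_wprod. Qed.
Lemma rhoM x y v : rho (x * y) v = rho x (rho y v).
Proof.
have [us <-] := wprod_surj x; have [vs <-] := wprod_surj y.
by rewrite -wprod_cat !rho_wprod act_cat.
Qed.
Lemma rhoK x v : rho x^-1 (rho x v) = v. Proof. by rewrite -rhoM mulVg rho1. Qed.
Lemma rhoVK x v : rho x (rho x^-1 v) = v. Proof. by rewrite -rhoM mulgV rho1. Qed.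
Lemma rho_inj x : injective (rho x). Proof. exact: can_inj (rhoK x). Qed.

Definition pos v := [forall t, (0 <= v t)%R].
Definition neg v := [forall t, (v t <= 0)%R].

Lemma posP v : reflect (forall t, (0 <= v t)%R) (pos v). Proof. exact: forallP. Qed.
Lemma neg_vecP v : reflect (forall t, (v t <= 0)%R) (neg v). Proof. exact: forallP. Qed.

Lemma posN v : pos (- v) = neg v.
Proof. by apply: eq_forallb => t; rewrite vecN oppr_ge0. Qed.
Lemma negN v : neg (- v) = pos v.
Proof. by rewrite -posN opprK. Qed.
Lemma posD v w : pos v -> pos w -> pos (v + w).
Proof. by move=> /posP hv /posP hw; apply/posP=> t; rewrite vecD addr_ge0. Qed.
Lemma posZ (a : Rf) v : (0 <= a)%R -> pos v -> pos (a *: v).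
Proof. by move=> ha /posP hv; apply/posP=> t; rewrite vecZ mulr_ge0. Qed.
Lemma pos_neg0 v : pos v -> neg v -> v = 0.
Proof.
move=> /posP hp /neg_vecP hn; apply/ffunP=> t.
by apply/eqP; rewrite vec0 eq_le hp hn.
Qed.
Lemma pos_alpha s : pos (alpha s).
Proof. by apply/posP=> t; rewrite alphaE ler0n. Qed.
Lemma alpha_neq0 s : alpha s != 0.
Proof.
apply/eqP=> /ffunP /(_ s); rewrite alphaE eqxx vec0 => /eqP.
by rewrite oner_eq0.
Qed.

Lemma rho_alt y k s t : s != t -> rho (y * wprod (alt k s t)) (alpha s) =
    cheb (cwt s t) k.+1 *: rho y (alpha (if odd k then t else s)) +
    cheb (cwt s t) k *: rho y (alpha (if odd k then s else t)).
Proof. by move=> st; rewrite rhoM rho_wprod act_alt // linearD !linearZ. Qed.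

(** Induction on the length: [x] is a shorter [z] times an alternating word in [s] and a descent
    [t]. The image is then a combination of [rho z (alpha s)] and [rho z (alpha t)] with nonnegative
    Chebyshev coefficients. *)
Lemma pos_of_len x s : len (x * g s) = (len x).+1 -> pos (rho x (alpha s)).
Proof.
have [n] := ubnP (len x); elim: n x s => // n IH x s xn xs.
have [->|x1] := eqVneq x 1; first by rewrite rho1 pos_alpha.
have [t [y [xE yl]]] := len_last x1.
have xt : (len (x * g t) < len x)%N by rewrite xE -mulgA gval2 mulg1 -xE yl.
have st : s != t by apply/eqP=> e; move: xt; rewrite -e; lia.
have [z [k [zE zl [zs zt] kn k0]]] := alt_decomp st xs.
have {}k0 := k0 xt.
have zn : (len z < n)%N by lia.
rewrite zE rho_alt //; apply: posD; apply: posZ.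
- exact: cwt_cheb_ge0.
- by case: (odd k); apply: IH.
- by apply: cwt_cheb_ge0 => // j /kn /ltnW.
- by case: (odd k); apply: IH.
Qed.

Definition desc x s := neg (rho x (alpha s)).

Lemma neg_of_len x s : len x = (len (x * g s)).+1 -> desc x s.
Proof.
move=> h; have := @pos_of_len (x * g s) s; rewrite -mulgA gval2 mulg1 => /(_ h).
by rewrite rhoM rho_gval sigma_alphas linearN posN.
Qed.

Lemma rho_neq0 x v : v != 0 -> rho x v != 0.
Proof. by apply: contra_neq => e; rewrite -(rhoK x v) e linear0. Qed.

Lemma not_desc x s : ~~ desc x s = pos (rho x (alpha s)).
Proof.
apply/idP/idP => [nd|p].
  by have [/pos_of_len//|/neg_of_len] := len_mulr x s; rewrite (negPf nd).
by apply/negP=> n; have := rho_neq0 x (alpha_neq0 s); rewrite (pos_neg0 p n) eqxx.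
Qed.

Lemma desc_len x s : desc x s -> len x = (len (x * g s)).+1.
Proof.
by move=> d; have [/pos_of_len|//] := len_mulr x s; rewrite -not_desc d.
Qed.

Lemma asc_len x s : ~~ desc x s -> len (x * g s) = (len x).+1.
Proof.
by move=> d; have [//|/neg_of_len] := len_mulr x s; rewrite (negPf d).
Qed.

Lemma desc_mulr x s : desc (x * g s) s = ~~ desc x s.
Proof. by rewrite not_desc /desc rhoM rho_gval sigma_alphas linearN negN. Qed.

Lemma exists_desc x : x != 1 -> exists s, desc x s.
Proof.
move/len_last => [s [y [xE yl]]]; exists s; apply: neg_of_len.
by rewrite {2}xE -mulgA gval2 mulg1.
Qed.

Lemma rho_faithful x y : (forall v, rho x v = rho y v) -> x = y.
Proof.
move=> h; apply/eqP; rewrite -[y]invgK -mulg_eq1; apply: contraT => /exists_desc [s].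
rewrite /desc rhoM h rhoVK => n; have := alpha_neq0 s.
by rewrite (pos_neg0 (pos_alpha s) n) eqxx.
Qed.

Lemma gval_inj : injective g.
Proof.
move=> s t e; have h : desc (g s) t by rewrite e -[g t]mul1g desc_mulr not_desc rho1 pos_alpha.
apply/eqP; apply: contraT => st; move: h.
rewrite /desc rho_gval sigma_alpha => /neg_vecP /(_ t).
rewrite vecD vecZ !alphaE eqxx [t == s]eq_sym (negPf st) mulr0 addr0.
by rewrite ler10.
Qed.

End Length.

Local Open Scope classical_set_scope.
(* Coordinates of vectors have type [Rf^o]; [0r] keeps equations between them in
   [Rf]. *)
Local Notation "0r" := (0%R : Rf).

(** * Roots and inversions *)

Section Roots.
Variable C : coxsys.
Local Notation X := (gen C).
Local Notation W := (grp C).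
Local Notation g := (@gval C).
Local Notation m := (@cm C).
Local Notation vec := {ffun X -> Rf^o}.
Implicit Types (s t u : X) (us vs : seq X) (x y z : W) (v w : vec).

(** Twice the Tits form, so that roots have square length 2 and reflections need no division. *)
Definition bf v w : Rf := (\sum_s w s * phi s v)%R.

Lemma bfC v w : bf v w = bf w v.
Proof.
have E v' w' : bf v' w' = (- \sum_s \sum_t cwt s t * (w' s * v' t))%R.
  rewrite /bf -sumrN; apply: eq_bigr => s _.
  by rewrite /phi mulrN mulr_sumr; congr (- _)%R; apply: eq_bigr => t _; ring.
rewrite !E exchange_big /=; congr (- _)%R; apply: eq_bigr => s _.
by apply: eq_bigr => t _; rewrite cwtC; ring.
Qed.

Lemma bfP (a : Rf) v v' w : bf (a *: v + v') w = (a * bf v w + bf v' w)%R.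
Proof.
rewrite /bf mulr_sumr -big_split; apply: eq_bigr => s _ /=.
by rewrite phiP; ring.
Qed.

Lemma bf_alpha v s : bf v (alpha s) = phi s v.
Proof.
rewrite /bf (bigD1 s) //= big1 ?addr0 ?alphaE ?eqxx ?mul1r //.
by move=> t /negPf ts; rewrite alphaE ts mul0r.
Qed.

Lemma sigmaE s v : sigma s v = (- phi s v) *: alpha s + v.
Proof. by rewrite /sigma -scaleNr addrC. Qed.

Lemma bf_sigma s v w : bf (sigma s v) (sigma s w) = bf v w.
Proof.
rewrite !sigmaE bfP ![bf _ ((- _) *: _ + _)]bfC !bfP bf_alpha !(bfC (alpha _)) !bf_alpha.
by rewrite phi_alpha cwt_diag (bfC w); ring.
Qed.

Lemma bf_rho x v w : bf (rho x v) (rho x w) = bf v w.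
Proof.
have [us <-] := wprod_surj x; rewrite !rho_wprod.
by elim: us => //= s us IH; rewrite bf_sigma.
Qed.

Lemma rho_refl x s v :
  rho (x * g s * x^-1) v = v - bf v (rho x (alpha s)) *: rho x (alpha s).
Proof.
rewrite !rhoM rho_gval sigmaE linearP /= rhoVK -bf_alpha -(bf_rho x) rhoVK.
by rewrite -scaleNr addrC.
Qed.

Definition isroot v := exists x s, v = rho x (alpha s).

Lemma root_alpha s : isroot (alpha s). Proof. by exists 1, s; rewrite rho1. Qed.
Lemma root_rho x v : isroot v -> isroot (rho x v).
Proof. by move=> [y [s ->]]; exists (x * y), s; rewrite rhoM. Qed.
Lemma bf_root v : isroot v -> bf v v = 2%R.
Proof. by move=> [y [s ->]]; rewrite bf_rho bf_alpha phi_alpha cwt_diag opprK. Qed.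
Lemma root_neq0 v : isroot v -> v != 0.
Proof. by move=> [y [s ->]]; apply/rho_neq0/alpha_neq0. Qed.
Lemma root_pos v : isroot v -> ~~ neg v = pos v.
Proof. by move=> [y [s ->]]; exact: not_desc. Qed.

(** The root is a nonnegative multiple of [alpha s], and its square length fixes the multiple. *)
Lemma root_line s v : isroot v -> pos v -> (forall t, t != s -> v t = 0r) -> v = alpha s.
Proof.
move=> rv /posP pv h; have e : v = v s *: alpha s.
  apply/ffunP=> t; rewrite vecZ alphaE; have [->|/h ->] := eqVneq t s.
    by rewrite mulr1.
  by rewrite mulr0.
have := bf_root rv; rewrite {1}e -[_ *: _]addr0 bfP bfC bf_alpha.
have -> : phi s v = (2 * v s)%R.
  by rewrite {1}e -[_ *: _]addr0 phiP phi_alpha cwt_diag /phi big1 ?oppr0 => [|t _];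
    rewrite ?vec0; ring.
have -> : bf 0 v = 0r.
  rewrite /bf big1 // => t _; rewrite /phi big1 ?oppr0 ?mulr0 // => u _.
  by rewrite vec0 mulr0.
move=> h2; rewrite e; suff -> : v s = 1%R by rewrite scale1r.
have := pv s; nra.
Qed.

Lemma root_simple s v : isroot v -> pos v -> neg (sigma s v) -> v = alpha s.
Proof.
move=> rv pv /neg_vecP n; apply: root_line => // t ts; apply/eqP; rewrite eq_le (posP _ pv) andbT.
by have := n t; rewrite sigmaE vecD vecZ alphaE (negPf ts) mulr0 add0r.
Qed.

(** Each letter adds at most one inversion: the root that the rest of the word carries to the simple
    root of that letter. *)
Lemma inversions x : exists L : seq vec, forall v, isroot v -> pos v -> neg (rho x v) -> v \in L.
Proof.
have [us <-] := wprod_surj x; elim: us => [|s us [L IH]].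
  exists [::] => v rv pv; rewrite wprod_nil rho1 => nv.
  by have := root_neq0 rv; rewrite (pos_neg0 pv nv) eqxx.
exists (rho (wprod us)^-1 (alpha s) :: L) => v rv pv; rewrite wprod_cons rhoM rho_gval => nv.
rewrite inE; have [n|] := boolP (neg (rho (wprod us) v)); first by rewrite IH ?orbT.
have ru := root_rho (wprod us) rv.
by rewrite root_pos // => p; rewrite -(root_simple ru p nv) rhoK eqxx.
Qed.

Definition invl x : seq vec := sval (cid (inversions x)).
Lemma invlP x v : isroot v -> pos v -> neg (rho x v) -> v \in invl x.
Proof. by rewrite /invl; case: cid => L /= h; apply: h. Qed.

(** An element is determined by the positive roots that it makes negative, here a subset of the
    finite list [L]. *)
Lemma finite_of_inversions (G : set W) (L : seq vec) :
  (forall x v, G x -> isroot v -> pos v -> neg (rho x v) -> v \in L) -> finite_set G.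
Proof.
move=> h; pose f x := [ffun i : 'I_(size L) => neg (rho x (tnth (in_tuple L) i))].
have f_inj x y : G x -> G y -> f x = f y -> x = y.
  move=> Gx Gy e; have same v : isroot v -> pos v -> neg (rho x v) = neg (rho y v).
    move=> rv pv; have inL : v \in L -> neg (rho x v) = neg (rho y v).
      move=> vL; have iL : (index v L < size L)%N by rewrite index_mem.
      have := congr1 (fun F : {ffun _} => F (Ordinal iL)) e.
      by rewrite !ffunE !(tnth_nth v) /= nth_index.
    apply/idP/idP => n; first by rewrite -inL // (h x).
    by rewrite inL // (h y).
  (* A descent [s] of $xy^{-1}$ yields the root $\pm y^{-1}\alpha_s$, whose positive representative
     is inverted by only one of [x] and [y]. *)
  apply/eqP; rewrite -[y]invgK -mulg_eq1; apply: contraT => /exists_desc [s].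
  rewrite /desc rhoM; set b := rho y^-1 (alpha s); have rb : isroot b by apply/root_rho/root_alpha.
  have yb : rho y b = alpha s by rewrite rhoVK.
  have np := pos_neg0 (pos_alpha s).
  have [nb|] := boolP (neg b); last first.
    rewrite root_pos // => pb; rewrite (same b) // yb => /np e0.
    by have := alpha_neq0 s; rewrite e0 eqxx.
  have r' : isroot (- b).
    case: rb => z [t bz]; exists (z * g t), t.
    by rewrite rhoM rho_gval sigma_alphas linearN bz.
  rewrite -[b in rho x b]opprK linearN negN /= => pp.
  have : neg (rho y (- b)) by rewrite linearN negN /= yb pos_alpha.
  rewrite -same ?posN // => nn; have := root_neq0 (root_rho x r').
  by rewrite (pos_neg0 pp nn) eqxx.
suff <- : finite_set (f @` G) = finite_set G by exact: finite_finset.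
apply: eq_finite_set; apply: inj_card_eq => x y /set_mem Gx /set_mem Gy.
exact: f_inj.
Qed.

End Roots.

(** * Parabolic subgroups *)

Section Parabolic.
Variable C : coxsys.
Local Notation X := (gen C).
Local Notation W := (grp C).
Local Notation g := (@gval C).
Local Notation m := (@cm C).
Local Notation vec := {ffun X -> Rf^o}.
Implicit Types (s t u : X) (us vs : seq X) (x y z : W) (v w : vec) (J T : {set X}).

Definition para J : set W := [set x | exists2 us, all [in J] us & wprod us = x].

Lemma para1 J : para J 1. Proof. by exists [::]; rewrite ?wprod_nil. Qed.
Lemma paraM J x y : para J x -> para J y -> para J (x * y).
Proof.
by move=> [us hu <-] [vs hv <-]; exists (us ++ vs); rewrite ?all_cat ?hu ?hv ?wprod_cat.
Qed.
Lemma paraV J x : para J x -> para J x^-1.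
Proof. by move=> [us hu <-]; exists (rev us); rewrite ?all_rev ?wprod_rev. Qed.
Lemma para_gval J s : s \in J -> para J (g s).
Proof. by move=> h; exists [:: s]; rewrite /= ?h ?wprod1. Qed.
Lemma paraS J T : J \subset T -> para J `<=` para T.
Proof. by move=> /fintype.subsetP h x [us hu <-]; exists us => //; apply: sub_all hu. Qed.

Definition spn J v := forall t, t \notin J -> v t = 0r.

Lemma spnP J (a : Rf) v w : spn J v -> spn J w -> spn J (a *: v + w).
Proof. by move=> hv hw t ht; rewrite vecD vecZ hv // hw // mulr0 addr0. Qed.
Lemma spn0 J : spn J 0. Proof. by move=> t _; rewrite vec0. Qed.
Lemma spnD J v w : spn J v -> spn J w -> spn J (v + w).
Proof. by move=> hv hw; rewrite -[v]scale1r; apply: spnP. Qed.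
Lemma spnZ J (a : Rf) v : spn J v -> spn J (a *: v).
Proof. by move=> hv; rewrite -[_ *: _]addr0; apply: spnP => //; apply: spn0. Qed.
Lemma spn_alpha J s : s \in J -> spn J (alpha s).
Proof.
move=> sJ t tJ; rewrite alphaE; case: eqVneq => // e.
by rewrite -e (negPf tJ) in sJ.
Qed.
Lemma spn_alphaP J s (a : Rf) : a != 0%R -> spn J (a *: alpha s) -> s \in J.
Proof.
move=> a0 h; apply: contraT => /h; rewrite vecZ alphaE eqxx mulr1 => e.
by rewrite e eqxx in a0.
Qed.

Lemma para_sub J x v : para J x -> spn J (rho x v - v).
Proof.
move=> [us + <-]; rewrite rho_wprod; elim: us v => [|s us IH] v /=.
  by move=> _; rewrite subrr; apply: spn0.
move=> /andP [sJ /(IH v) h]; rewrite sigmaE -addrA; apply: spnP => //.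
exact: spn_alpha.
Qed.

Lemma spn_rho J x v : para J x -> spn J v -> spn J (rho x v).
Proof. by move=> hx hv; rewrite -(subrK v (rho x v)); apply: spnD hv; apply: para_sub. Qed.

Lemma para_gvalP J s : para J (g s) -> s \in J.
Proof.
move/(para_sub (alpha s)); rewrite rho_gval sigma_alphas -opprD -mulr2n -scaler_nat -scaleNr.
by apply: spn_alphaP; rewrite oppr_eq0 pnatr_eq0.
Qed.

Lemma rho_sum x v t : (rho x v) t = (\sum_s v s * rho x (alpha s) t)%R.
Proof.
rewrite {1}(vec_sum v) linear_sum sum_ffunE; apply: eq_bigr => s _.
by rewrite linearZ vecZ.
Qed.

Lemma neg_rho x v : neg v -> (forall s, v s != 0%R -> pos (rho x (alpha s))) -> neg (rho x v).
Proof.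
move=> /neg_vecP nv h; apply/neg_vecP => t; rewrite rho_sum; apply: sumr_le0 => s _.
have [->|/h /posP p] := eqVneq (v s) 0%R; first by rewrite mul0r.
exact: mulr_le0_ge0.
Qed.

(* If all of [J] are right descents of [x], then the positive roots of the
   parabolic subgroup generated by [J] are all inverted by [x]. *)
Lemma finite_para_desc J x : (forall s, s \in J -> desc x s) -> finite_set (para J).
Proof.
move=> h; apply: (@finite_of_inversions _ _ (invl x)) => y v py rv pv nv.
(* Outside [J] the coordinates are unchanged by [y], hence both nonnegative and nonpositive. *)
have vJ : spn J v.
  move=> t tJ; have /eqP := para_sub v py tJ; rewrite vecD vecN subr_eq0 => /eqP e.
  apply/eqP; rewrite eq_le (posP _ pv) andbT -e; exact: (neg_vecP _ nv).
apply: invlP => //; rewrite -posN -linearN; rewrite -negN.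
rewrite -linearN opprK; apply/neg_vecP => t; rewrite rho_sum; apply: sumr_le0 => s _.
have [sJ|sJ] := boolP (s \in J); last by rewrite vJ // mul0r.
by rewrite mulr_ge0_le0 ?(posP _ pv) //; apply: (neg_vecP _ (h s sJ)).
Qed.

Lemma longest J : finite_set (para J) ->
  exists2 x, para J x & forall y, para J y -> (len y <= len x)%N.
Proof.
move/finite_seqP=> [S eS]; pose P k := `[< exists2 x, para J x & len x = k >].
have P0 : exists k, P k by exists 0; apply/asboolP; exists 1; [exact: para1|exact: len1].
have Pb k : P k -> (k <= \max_(x <- S) len x)%N.
  by move/asboolP=> [x + <-]; rewrite eS /= => xS; apply: leq_bigmax_seq.
case: (ex_maxnP P0 Pb) => k /asboolP [x px <-] kmax; exists x => // y py.
by apply: kmax; apply/asboolP; exists y.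
Qed.

Lemma longest_desc J : finite_set (para J) ->
  exists2 x, para J x & forall s, s \in J -> desc x s.
Proof.
move/longest=> [x px xmax]; exists x => // s sJ; apply: contraT => /asc_len e.
by have := xmax _ (paraM px (para_gval sJ)); rewrite e ltnn.
Qed.

Definition maxsph T := finite_set (para T) /\ forall u, u \notin T -> ~ finite_set (para (u |: T)).

(* With [x] shortest in its double coset, [rho x] maps the simple roots of [T]
   to simple roots; a right descent [u] of [x] would then be, together with all
   of [T], a descent of [x] times the longest element of [para T]. *)
Lemma conj_maxsph T T' x : maxsph T -> (forall t, t \in T -> spn T' (rho x (alpha t))) ->
  T \subset T' /\ para T' x.
Proof.
move=> [finT maxT]; have [n] := ubnP (len x); elim: n x => // n IH x xn hT.
have [/exists_inP [t tT dt]|/exists_inPn ascT] := boolP [exists t in T, desc x t].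
  have lx := desc_len dt; case: (IH (x * g t)); first by lia.
    move=> s sT; rewrite rhoM rho_gval sigma_alpha linearD linearZ /=.
    by apply: spnD; [exact: hT | apply: spnZ; exact: hT].
  move=> TT' px; split=> //; rewrite -[x]mulg1 -(gval2 t) mulgA; apply: paraM px _.
  by apply: para_gval; apply: (fintype.subsetP TT').
have [/exists_inP [t tT dt]|/exists_inPn ascT'] := boolP [exists t in T', desc x^-1 t].
  have lx := desc_len dt; rewrite lenV -[g t]gvalV -invgM lenV in lx.
  case: (IH (g t * x)); first by rewrite -ltnS -lx.
    move=> s sT; rewrite rhoM rho_gval sigmaE.
    by apply: spnP; [exact: spn_alpha | exact: hT].
  move=> TT' px; split=> //; rewrite -[x]mul1g -(gval2 t) -mulgA; apply: paraM px.
  exact: para_gval.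
(* The simple root [alpha t] is a nonnegative combination of the positive roots
   [rho x^-1 (alpha t')], so each root that occurs is [alpha t] itself. *)
have simple t : t \in T -> exists2 t', t' \in T' & rho x (alpha t) = alpha t'.
  move=> tT; pose b := rho x (alpha t).
  have pb : pos b by rewrite -not_desc ascT.
  have : b != 0 by apply/rho_neq0/alpha_neq0.
  have [/existsP [t' b0] _|/existsPn h] := boolP [exists t', b t' != 0%R]; last first.
    move/eqP; case; apply/ffunP=> t'; rewrite vec0.
    by apply/eqP; have := h t'; rewrite negbK.
  have tT' : t' \in T' by apply: contraNT b0 => /(hT t tT) e; apply/eqP.
  exists t' => //; suff e : rho x^-1 (alpha t') = alpha t by rewrite -e rhoVK.
  apply: root_line; first exact/root_rho/root_alpha.
    by rewrite -not_desc ascT'.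
  move=> u ut; have /eqP : rho x^-1 b u = 0r by rewrite rhoK alphaE (negPf ut).
  rewrite rho_sum psumr_eq0.
    move=> /allP /(_ t'); rewrite mem_index_enum => /(_ isT) /=.
    by rewrite mulf_eq0 (negPf b0) => /eqP.
  move=> s _; have [sT'|/(hT t tT) ->] := boolP (s \in T'); last by rewrite mul0r.
  by rewrite mulr_ge0 ?(posP _ pb) //; apply: posP; rewrite -not_desc ascT'.
have [x1|/exists_desc [u du]] := eqVneq x 1.
  split; last by rewrite x1; exact: para1.
  apply/fintype.subsetP=> t tT; have [t' t'T] := simple t tT; rewrite x1 rho1 => e.
  have := spn_alpha t'T; rewrite -e -[alpha t]scale1r; apply: spn_alphaP.
  by rewrite oner_eq0.
have uT : u \notin T by apply: contraTN du => /ascT.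
have [y py dy] := longest_desc finT.
case: (maxT u uT); apply: (@finite_para_desc _ (x * y)) => s; rewrite in_setU1.
case/orP=> [/eqP ->|sT]; last first.
  rewrite /desc rhoM; apply: neg_rho; first exact: dy.
  move=> t h; have tT : t \in T.
    apply: contraNT h => tT; apply/eqP.
    by rewrite (spn_rho py (spn_alpha sT)).
  by rewrite -not_desc ascT.
apply: contraT; rewrite not_desc rhoM => /posP p.
(* Off the images of [T], the positive vector [rho x (rho y (alpha u))] and the negative vector
   [rho x (alpha u)] have equal coordinates, hence zero; then [alpha u] would lie in the span of
   [T]. *)
set d := rho y (alpha u) - alpha u; have dT : spn T d by exact: para_sub.
pose T'' := [set t' | [exists t in T, rho x (alpha t) == alpha t']]%SET.
have xT t' : t' \notin T'' -> rho x (alpha u) t' = 0r.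
  move=> h; apply/eqP; rewrite eq_le (neg_vecP _ du) /=.
  have := p t'; rewrite -[rho y _](subrK (alpha u)) -/d linearD vecD.
  suff -> : rho x d t' = 0r by rewrite add0r.
  rewrite rho_sum big1 // => t _; have [tT|/dT ->] := boolP (t \in T); last by rewrite mul0r.
  have [t2 _ e] := simple t tT; rewrite e alphaE; case: eqVneq => [e2|]; last by rewrite mulr0.
  case/negP: h; rewrite inE; apply/exists_inP; exists t => //.
  by rewrite e e2.
have /eqP : alpha u u = 0r.
  rewrite -[alpha u in LHS](rhoK x) rho_sum big1 // => t' _.
  have [|/xT ->] := boolP (t' \in T''); last by rewrite mul0r.
  rewrite inE => /exists_inP [t tT /eqP <-]; rewrite rhoK alphaE.
  case: eqVneq => [e|]; last by rewrite mulr0.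
  by rewrite e tT in uT.
by rewrite alphaE eqxx oner_eq0.
Qed.

End Parabolic.

(** * Finite subgroups *)

Section FiniteSubgroups.
Variable C : coxsys.
Local Notation X := (gen C).
Local Notation W := (grp C).
Local Notation g := (@gval C).
Local Notation m := (@cm C).
Local Notation vec := {ffun X -> Rf^o}.
Implicit Types (s t u : X) (us vs : seq X) (x y z : W) (v w : vec) (J T : {set X}).

(** * Linear functionals and their stabilizers *)

Section Functional.
Variable q : vec -> Rf.
Hypothesis qP : forall (a : Rf) v w, q (a *: v + w) = (a * q v + q w)%R.

Lemma functional_sum v : q v = (\sum_s v s * q (alpha s))%R.
Proof.
rewrite {1}(vec_sum v); have q0 : q 0 = 0r.
  have := qP 1%R 0 0; rewrite scaler0 addr0 mul1r => /eqP.
  by rewrite -subr_eq0 opprD addNKr oppr_eq0 => /eqP.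
by elim/big_rec2: _ => [|s a v' _ <-]; rewrite ?q0 ?qP.
Qed.

Lemma functional_le0 v : (forall s, 0 <= q (alpha s))%R -> neg v -> (q v <= 0)%R.
Proof.
move=> h /neg_vecP nv; rewrite functional_sum; apply: sumr_le0 => s _.
by rewrite mulr_le0_ge0.
Qed.

Definition qzero : {set X} := [set s | q (alpha s) == 0r]%SET.

Lemma functional_sigma s v : s \in qzero -> q (sigma s v) = q v.
Proof. by rewrite inE sigmaE qP => /eqP ->; rewrite mulr0 add0r. Qed.

Lemma functional_para x v : para qzero x -> q (rho x v) = q v.
Proof.
move=> [us + <-]; rewrite rho_wprod; elim: us => //= s us IH /andP [hs hus].
by rewrite functional_sigma // IH.
Qed.

(** At a descent [s] of [x] the dominant functional is nonnegative on [alpha s] and, by invariance,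
    nonpositive; so [s] fixes it and can be split off. *)
Lemma functional_stab x : (forall s, 0 <= q (alpha s))%R ->
  (forall v, q (rho x v) = q v) -> para qzero x.
Proof.
move=> h; have [n] := ubnP (len x); elim: n x => // n IH x xn hx.
have [->|/exists_desc [s ds]] := eqVneq x 1; first exact: para1.
have sq : s \in qzero by rewrite inE eq_le h andbT -hx functional_le0.
rewrite -[x]mulg1 -(gval2 s) mulgA; apply: paraM (para_gval sq); apply: IH.
  by rewrite -ltnS -(desc_len ds).
by move=> v; rewrite rhoM hx rho_gval functional_sigma.
Qed.

End Functional.

(** Reflecting in a simple root of negative value permutes the other positive roots, so the list
    bounding the negative values gets shorter. *)
Lemma make_dominant (q : vec -> Rf) (L : seq vec) :
  (forall (a : Rf) v w, q (a *: v + w) = a * q v + q w)%R ->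
  (forall v, isroot v -> pos v -> (q v < 0)%R -> v \in L) ->
  exists x, forall s, (0 <= q (rho x (alpha s)))%R.
Proof.
move=> qP hL; have {hL}: forall v, isroot v -> pos v -> (q (rho 1 v) < 0)%R -> v \in L.
  by move=> v; rewrite rho1; apply: hL.
have [n] := ubnP (size L); elim: n L 1 => // n IH L x Ln hL.
have [/existsP [s hs]|/existsPn h] := boolP [exists s, (q (rho x (alpha s)) < 0)%R]; last first.
  by exists x => s; rewrite leNgt.
have sL : alpha s \in L by apply: hL hs; [exact: root_alpha | exact: pos_alpha].
apply: (IH [seq sigma s v | v <- rem (alpha s) (undup L)] (x * g s)).
  rewrite size_map size_rem ?mem_undup //; have := size_undup L.
  by case: L sL Ln {hL} => // a L _ /=; lia.
move=> v rv pv; rewrite rhoM rho_gval => hv.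
have sK : sigma s (sigma s v) = v by rewrite -!rho_gval -rhoM gval2 rho1.
have vs : v != alpha s.
  apply: contraTneq hv => ->; rewrite sigma_alphas -leNgt linearN /=.
  have := qP (-1)%R (rho x (alpha s)) 0; rewrite scaleN1r addr0 => ->.
  have -> : q 0 = 0r by rewrite functional_sum // big1 // => t _; rewrite vec0 mul0r.
  by rewrite addr0 mulN1r oppr_ge0 ltW.
have rsv : isroot (sigma s v) by rewrite -rho_gval; apply: root_rho.
have psv : pos (sigma s v).
  rewrite -root_pos //; apply: contra vs => n'.
  by apply/eqP; apply: root_simple.
rewrite -sK map_f // (rem_filter _ (undup_uniq L)) mem_filter mem_undup hL // andbT /=.
apply: contraTneq pv => e; rewrite -sK e sigma_alphas posN.
apply/negP=> n'; have := alpha_neq0 s.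
by rewrite (pos_neg0 (pos_alpha s) n') eqxx.
Qed.

(* The functional [p], summing the height over the orbit under [F], is
   [F]-invariant and negative on finitely many positive roots only; it
   therefore lies in the Tits cone. *)
Lemma finite_conj_para (F : set W) : is_subgroup F -> finite_set F ->
  exists x J, finite_set (para J) /\ forall y, F y -> para J (x^-1 * y * x).
Proof.
move=> [F1 FM FV] /finite_seqP [S0 eF]; pose S := undup S0.
have FS y : F y <-> y \in S by rewrite mem_undup eF.
pose p v : Rf := (\sum_(f <- S) \sum_s rho f v s)%R.
have pP (a : Rf) v w : p (a *: v + w) = (a * p v + p w)%R.
  rewrite /p mulr_sumr -big_split; apply: eq_bigr => f _ /=.
  rewrite mulr_sumr -big_split; apply: eq_bigr => s _ /=.
  by rewrite linearP vecD vecZ.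
have pF y v : F y -> p (rho y v) = p v.
  move=> Fy; have pS : perm_eq [seq f * y | f <- S] S.
    apply: uniq_perm; rewrite ?undup_uniq ?map_inj_uniq ?undup_uniq //; first exact: mulIg.
    move=> z; apply/mapP/idP => [[f /FS Ff ->]|/FS Fz]; first by apply/FS; apply: FM.
    by exists (z * y^-1); rewrite ?mulgVK //; apply/FS; apply: FM => //; apply: FV.
  rewrite /p -[RHS](perm_big _ pS) big_map.
  by apply: eq_bigr => f _; apply: eq_bigr => s _; rewrite rhoM.
(* If all images were positive, the sum would be strictly positive because of the summand of the
   identity. Including the value zero is what later makes the stabilizer finite. *)
have p_neg x v : isroot v -> (p (rho x v) <= 0)%R -> exists2 f, f \in S & neg (rho (f * x) v).
  move=> rv; have [/hasP [f fS nf] _|/hasPn h] := boolP (has (fun f => neg (rho (f * x) v)) S).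
    by exists f.
  have S1 : 1 \in S by apply/FS.
  have hp f : f \in S -> pos (rho f (rho x v)).
    by move=> /h; rewrite root_pos rhoM //; do 2!apply: root_rho.
  have ht f : f \in S -> (0 <= \sum_s rho f (rho x v) s)%R.
    by move=> /hp /posP hf; apply: sumr_ge0.
  rewrite leNgt => /negP; case; rewrite /p lt_neqAle; apply/andP; split; last first.
    by rewrite big_seq_cond; apply: sumr_ge0 => f; rewrite andbT; apply: ht.
  rewrite eq_sym big_seq_cond psumr_eq0; last by move=> f; rewrite andbT; apply: ht.
  apply/negP=> /allP /(_ 1 S1); rewrite S1 /= psumr_eq0.
    move=> /allP h0; have /eqP := root_neq0 (root_rho 1 (root_rho x rv)); case.
    by apply/ffunP=> s; rewrite vec0; apply/eqP; apply: h0; rewrite mem_index_enum.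
  by move=> s _; apply: posP; apply: hp.
pose L x := flatten [seq invl (f * x) | f <- S].
have LP x v : isroot v -> pos v -> (p (rho x v) <= 0)%R -> v \in L x.
  move=> rv pv /(p_neg x v rv) [f fS nf]; apply/flattenP; exists (invl (f * x)).
    by apply/mapP; exists f.
  exact: invlP.
have [x hx] : exists x, forall s, (0 <= p (rho x (alpha s)))%R.
  apply: (@make_dominant p (L 1)) => // v rv pv /ltW h.
  by apply: LP => //; rewrite rho1.
pose q v := p (rho x v).
have qP (a : Rf) v w : q (a *: v + w) = (a * q v + q w)%R by rewrite /q linearP /= pP.
exists x, (qzero q); split.
  (* A positive root [v] inverted by [y] satisfies [q v = q (rho y v) <= 0]. *)
  apply: (@finite_of_inversions _ _ (L x)) => y v py rv pv nv.
  by apply: LP => //; rewrite -/(q v) -(functional_para qP v py) functional_le0.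
move=> y Fy; apply: functional_stab => // v.
by rewrite /q -!mulgA !rhoM rhoVK pF.
Qed.

End FiniteSubgroups.

(** * Dihedral parabolic subgroups *)

Section Dihedral.
Variable C : coxsys.
Local Notation X := (gen C).
Local Notation W := (grp C).
Local Notation g := (@gval C).
Local Notation m := (@cm C).
Local Notation vec := {ffun X -> Rf^o}.
Implicit Types (s t u : X) (us vs : seq X) (x y z : W) (v w : vec) (J T : {set X}).

Lemma asc_alt k s t : s != t -> (forall n, m s t = Some n -> (k < n)%N) ->
  ~~ desc (wprod (alt k s t)) s.
Proof.
move=> st kn; rewrite not_desc -[wprod _]mul1g rho_alt // !rho1.
apply: posD; apply: posZ; rewrite ?pos_alpha //; apply: cwt_cheb_ge0 => // n /kn //.
exact: ltnW.
Qed.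

Lemma desc_alt k s t : s != t -> (forall n, m s t = Some n -> (k < n)%N) ->
  desc (wprod (alt k.+1 s t)) t.
Proof.
move=> st kn; rewrite /= wprod_rcons desc_mulr; apply: asc_alt; first by rewrite eq_sym.
by move=> n; rewrite cmC; apply: kn.
Qed.

Lemma len_alt k s t : s != t -> (forall n, m s t = Some n -> (k <= n)%N) ->
  len (wprod (alt k s t)) = k.
Proof.
elim: k s t => [|k IH] s t st kn; first by rewrite wprod_nil len1.
rewrite /= wprod_rcons asc_len ?IH 1?eq_sym // ?asc_alt 1?eq_sym //.
  by move=> n; rewrite cmC => /kn /ltnW.
by move=> n; rewrite cmC => /kn.
Qed.

Lemma edge_spherical n s t : s != t -> m s t = Some n -> finite_set (para [set s; t]%SET).
Proof.
move=> st mst; apply: (@finite_para_desc _ _ (wprod (alt n s t))) => u.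
have n2 := cm_ge2 st mst; case: n mst n2 => // n mst _.
rewrite !inE => /orP [] /eqP ->; last first.
  by apply: desc_alt => // k; rewrite mst => -[<-].
rewrite (wprod_altC mst); apply: desc_alt; first by rewrite eq_sym.
by move=> k; rewrite cmC mst => -[<-].
Qed.

Lemma alt_sub k s t : all [in [set s; t]%SET] (alt k s t).
Proof.
elim: k s t => //= k IH s t; rewrite all_rcons !inE eqxx orbT /=.
by apply: sub_all (IH t s) => u; rewrite !inE orbC.
Qed.

(** With an infinite label the alternating words have unbounded length, which contradicts a longest
    element. *)
Lemma spherical_edge s t : s != t -> finite_set (para [set s; t]%SET) -> exists n, m s t = Some n.
Proof.
move=> st /longest [x _ h]; case mst: (m s t) => [n|]; first by exists n.
have px : para [set s; t]%SET (wprod (alt (len x).+1 s t)).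
  by exists (alt (len x).+1 s t); rewrite ?alt_sub.
by have := h _ px; rewrite len_alt ?ltnn // => n; rewrite mst.
Qed.

Section Edge.
Variables (n : nat) (s t : X).
Hypotheses (st : s != t) (mst : m s t = Some n).
Let r := g s * g t.
Let n2 : (2 <= n)%N. Proof. exact: cm_ge2 st mst. Qed.

Let rn : r ^+ n = 1. Proof. exact: braid_order. Qed.
Let rV : r^-1 = g t * g s. Proof. by rewrite /r invgM !gvalV. Qed.
Let sr : g s * r = r^-1 * g s. Proof. by rewrite rV /r mulgA gval2 mul1g -mulgA gval2 mulg1. Qed.

(** A nonzero remainder [j < n] would equate the two alternating words of length [j], whose descents
    differ. *)
Lemma edge_order k : (g s * g t) ^+ k = 1 -> (n %| k)%N.
Proof.
have main p q j : p != q -> m p q = Some n -> (0 < j < n)%N ->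
    wprod (alt j p q) <> wprod (alt j q p).
  move=> pq mpq /andP [j0 jn] e.
  have : ~~ desc (wprod (alt j p q)) q.
    by rewrite e; apply: asc_alt => [|k']; rewrite 1?eq_sym // cmC mpq => -[<-].
  apply/negP; rewrite negbK; case: j j0 jn {e} => // j _ jn; apply: desc_alt => // k'.
  by rewrite mpq => -[<-]; exact: ltnW.
rewrite -/r => rk; rewrite /dvdn; apply: contraT; rewrite -lt0n => k0.
have kn : (k %% n < n)%N by rewrite ltn_mod; lia.
have {}rk : r ^+ (k %% n)%N = 1.
  by move: rk; rewrite {1}(divn_eq k n) expgnDr mulnC expgnA rn expg1n mul1g.
move: (k %% n)%N k0 kn rk => j j0 jn rj.
have h := alt_cat j j s t; rewrite addnn in h.
have : wprod (alt j s t) = wprod (alt j t s).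
  apply/eqP; rewrite -[X in _ == X]invgK -mulg_eq1 -wprod_rev rev_alt -wprod_cat h.
  case: ifP => _; rewrite wprod_alt_double; last exact/eqP.
  by rewrite -rV expVgn rj invg1.
by move/(main _ _ _ st mst); rewrite j0 jn => /(_ isT).
Qed.

Lemma edge_elt x : para [set s; t]%SET x ->
  (exists k, x = (g s * g t) ^+ k) \/ (exists k, x = (g s * g t) ^+ k * g s).
Proof.
rewrite -/r => -[us + <-]; elim/last_ind: us => [|us u IH].
  by move=> _; left; exists 0; rewrite wprod_nil.
rewrite all_rcons wprod_rcons => /andP [+ /IH]; rewrite !inE => /orP [] /eqP -> [] [k ->].
- by right; exists k.
- by left; exists k; rewrite -mulgA gval2 mulg1.
- right; exists (k + n.-1)%N; rewrite expgnDr -!mulgA; congr (_ * _).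
  have -> : r ^+ n.-1 = r^-1.
    by apply: (mulgI r); rewrite -expgS prednK ?rn ?mulgV //; lia.
  by rewrite -sr /r mulgA gval2 mul1g.
- by left; exists k.+1; rewrite expgSr /r !mulgA.
Qed.

Let srk k : r ^+ k * g s = g s * r ^- k.
Proof.
elim: k => [|k IH]; first by rewrite invg1 mulg1 mul1g.
have rs : r * g s = g s * r^-1 by apply: (mulgI r^-1); rewrite mulKg mulgA -sr mulgK.
by rewrite [in LHS]expgS -mulgA IH mulgA rs -mulgA expgSr (invgM (r ^+ k) r).
Qed.

(** Conjugation by a power of the rotation absorbs its even powers; the parity of [k] decides
    between [s] and [t]. *)
Lemma edge_refl k : exists u y, u \in [set s; t]%SET /\ (g s * g t) ^+ k * g s = y * g u * y^-1.
Proof.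
rewrite -/r -(odd_double_half k); set j := k./2.
have e : r ^+ j.*2 * g s = r ^+ j * g s * r ^- j.
  by rewrite -addnn expgnDr -!mulgA srk.
case: (odd k); last by exists s, (r ^+ j); rewrite !inE eqxx add0n e.
exists t, (r ^+ j * g s); rewrite !inE eqxx orbT; split=> //.
rewrite expgnDr -mulgA e expg1 !invgM gvalV mulgA.
have -> : r * (r ^+ j * g s) = r ^+ j * g s * g t * g s.
  by rewrite !mulgA -expgS expgSr /r !mulgA.
by rewrite !mulgA.
Qed.

Lemma edge_refl2 k : ((g s * g t) ^+ k * g s) ^+ 2 = 1.
Proof.
have [u [y [_ ->]]] := edge_refl k.
by rewrite expg2 !mulgA mulgVK -(mulgA y) gval2 mulg1 mulgV.
Qed.

(** A rotation of order 2 is $r^{n/2}$, which is the longest element and requires [n] even. *)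
Lemma edge_involution x : para [set s; t]%SET x -> x != 1 -> x ^+ 2 = 1 ->
  (exists u y, x = y * g u * y^-1) \/ (~~ odd n /\ x = wprod (alt n s t)).
Proof.
move=> /edge_elt [[k ->]|[k ->]] x1 x2; last first.
  by left; have [u [y [_ ->]]] := edge_refl k; exists u, y.
right; have nk : ~~ (n %| k)%N.
  apply: contra x1 => /dvdnP [j ->].
  by rewrite mulnC expgnA braid_order // expg1n.
have /edge_order n2k : (g s * g t) ^+ (k * 2) = 1 by rewrite expgnA.
have [j kj] := dvdnP n2k.
have on : ~~ odd n.
  apply: contra nk => on; rewrite -(@Gauss_dvdl _ _ 2) //.
  by rewrite coprime_sym prime_coprime // dvdn2 on.
split=> //; have nE : n = n./2.*2 by rewrite -[LHS]odd_double_half (negPf on).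
have kE : k = (j * n./2)%N by move: kj; rewrite [in (j * n)%N]nE; nia.
have oj : odd j.
  apply: contraNT nk => ej; apply/dvdnP; exists j./2.
  have jE : j = j./2.*2 by lia.
  move: kj; rewrite [in (j * n)%N]jE; nia.
rewrite [in RHS]nE wprod_alt_double kE -[j]odd_double_half oj mulnDl mul1n expgnDr.
have -> : (j./2.*2 * n./2 = n * j./2)%N by lia.
by rewrite expgnA (braid_order mst) expg1n mulg1.
Qed.

Lemma edge_center u : ~~ odd n -> u \in [set s; t]%SET ->
  rho (wprod (alt n s t)) (alpha u) = - alpha u.
Proof.
move=> on; have hn : cheb (cwt s t) n = 0r by rewrite /cwt mst cheb_kappa_n.
have hp : cheb (cwt s t) n.-1 = 1%R by rewrite /cwt mst cheb_kappa_pred.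
have hs : cheb (cwt s t) n.+1 = (-1)%R.
  have := cheb_kappa_addn n2 1; rewrite -mst -/(cwt s t) addn1 cheb1 //.
rewrite !inE => /orP [] /eqP ->.
  by rewrite -[wprod _]mul1g rho_alt // hn hs (negPf on) scale0r addr0 scaleN1r rho1.
have en : n = n.-1.+1 by lia.
rewrite rho_wprod [in alt n _ _]en /= act_rcons sigma_alphas linearN /=.
rewrite act_alt 1?eq_sym // -en (cwtC t s) hn hp scale0r add0r scale1r.
by have -> : odd n.-1 by lia.
Qed.

End Edge.

(** The reflection sends its root $b$ to $-b$, while [para J] moves vectors only within the span of
    [J], so $-2b$ lies there. This turns inclusions between conjugates into the hypothesis of
    [conj_maxsph]. *)
Lemma conj_spn x s J : para J (x * g s * x^-1) -> spn J (rho x (alpha s)).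
Proof.
set b := rho x (alpha s); move/(para_sub b); rewrite rho_refl -/b bf_root; last first.
  by exists x, s.
rewrite addrAC subrr add0r => /(spnZ (-2^-1)%R).
by rewrite scalerN scalerA mulNr scaleNr opprK mulVf ?pnatr_eq0 // scale1r.
Qed.

Lemma para0 x : para finset.set0 x -> x = 1.
Proof.
case=> -[|s us] /=; first by move=> _ <-; rewrite wprod_nil.
by rewrite finset.in_set0.
Qed.

Lemma para_set1 s x : para [set s]%SET x -> x = 1 \/ x = g s.
Proof.
case=> us + <-; elim: us => [|u us IH] /=; first by left; rewrite wprod_nil.
rewrite inE wprod_cons => /andP [/eqP -> /IH []] ->; first by right; rewrite mulg1.
by left; rewrite gval2.
Qed.

Definition dim2 := forall J, finite_set (para J) -> (#|J| <= 2)%N.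

Lemma edge_maxsph n s t : dim2 -> s != t -> m s t = Some n -> maxsph [set s; t]%SET.
Proof.
move=> hd st mst; split; first exact: edge_spherical mst.
by move=> u uT /hd; rewrite cardsU1 uT cards2 st.
Qed.

Lemma involution_cases x : dim2 -> x != 1 -> x ^+ 2 = 1 ->
  (exists s y, x = y * g s * y^-1) \/
  (exists s t n y, [/\ s != t, m s t = Some n, ~~ odd n & x = y * wprod (alt n s t) * y^-1]).
Proof.
move=> hd x1 x2.
have [|//|y [J [fJ hJ]]] := @finite_conj_para C [set 1; x].
- split; first by left.
    by move=> a b [] -> [] ->; rewrite ?mul1g ?mulg1; [left|right|right|left; rewrite -expg2].
  move=> a [] ->; [by left; rewrite invg1|right].
  by apply: (mulgI x); rewrite mulgV -expg2 x2.
set z := y^-1 * x * y; have pz : para J z by apply: hJ; right.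
have xE : x = y * z * y^-1 by rewrite /z !mulgA mulgV mul1g mulgK.
have z1 : z != 1 by apply: contra x1 => /eqP e; rewrite xE e mulg1 mulgV.
have z2 : z ^+ 2 = 1.
  rewrite /z expg2 !mulgA mulgK -(mulgA _ x x) -expg2 x2 mulg1 mulVg //.
have [J2|J2] := eqVneq #|J| 2%N.
  have /cards2P [s [t [st JE]]] : #|J| == 2%N by apply/eqP.
  rewrite JE in fJ pz; have [n mst] := spherical_edge st fJ.
  have [[u [y' zE]]|[on zE]] := edge_involution st mst pz z1 z2.
    by left; exists u, (y * y'); rewrite xE zE invgM !mulgA.
  by right; exists s, t, n, y; rewrite xE zE.
have [J1|J1] := eqVneq #|J| 1%N.
  have /cards1P [s JE] : #|J| == 1%N by apply/eqP.
  rewrite JE in pz; case: (para_set1 pz) => zE; first by rewrite zE eqxx in z1.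
  by left; exists s, y; rewrite xE zE.
have : #|J| == 0 by have := hd _ fJ; lia.
rewrite cards_eq0 => /eqP JE; rewrite JE in pz.
by rewrite (para0 pz) eqxx in z1.
Qed.

End Dihedral.

(** * Edges as conjugacy classes of maximal finite subgroups *)

Definition conj_in (W : groupType) (F H : set W) := exists x, forall y, F y -> H (x^-1 * y * x).

Lemma conj_in_trans (W : groupType) (F H K : set W) : conj_in F H -> conj_in H K -> conj_in F K.
Proof.
move=> [x hx] [y hy]; exists (x * y) => z Fz.
have -> : (x * y)^-1 * z * (x * y) = y^-1 * (x^-1 * z * x) * y by rewrite invgM !mulgA.
exact/hy/hx.
Qed.

(** Purely group-theoretic properties that pin down the index set and the numbers [n i]. Two
    distinct nontrivial elements exclude subgroups of order 2; the last fields locate [n i] among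
    the orders of elements. *)
Record dihedral_family (W : groupType) (I : finType) (H : I -> set W) (n : I -> nat) : Prop := {
  dih_group : forall i, is_subgroup (H i);
  dih_finite : forall i, finite_set (H i);
  dih_large : forall i, exists a b, [/\ H i a, H i b, a != 1, b != 1 & a != b];
  dih_conj : forall F, is_subgroup F -> finite_set F ->
    (exists a b, [/\ F a, F b, a != 1, b != 1 & a != b]) -> exists i, conj_in F (H i);
  dih_inj : forall i j, conj_in (H i) (H j) -> i = j;
  dih_ge2 : forall i, (2 <= n i)%N;
  dih_rot : forall i, exists2 r, H i r & forall k, r ^+ k = 1 -> (n i %| k)%N;
  dih_exp : forall i y, H i y -> y ^+ n i = 1 \/ y ^+ 2 = 1 }.

Section TwoFamilies.
Variable W : groupType.

Lemma dihedral_le (I I' : finType) (H : I -> set W) (H' : I' -> set W) n n' i j :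
  dihedral_family H n -> dihedral_family H' n' -> conj_in (H i) (H' j) -> (n i <= n' j)%N.
Proof.
move=> hH hH' [x hx]; have [r /hx Hr rord] := dih_rot hH i.
have conjX k : (x^-1 * r * x) ^+ k = 1 -> r ^+ k = 1.
  have -> : x^-1 * r * x = r ^ x by rewrite conjgE mulgA.
  by move=> h; apply/eqP; rewrite -(conjg_eq1 _ x) conjXg h.
have n2 := dih_ge2 hH' j.
case: (dih_exp hH' Hr) => /conjX /rord /dvdn_leq; lia.
Qed.

(** Going over and back puts [H i] inside a conjugate of some member of the same family, which
    [dih_inj] identifies as [H i]; the two inclusions bound the labels from both sides. *)
Lemma dihedral_transfer (I I' : finType) (H : I -> set W) (H' : I' -> set W) n n' :
  dihedral_family H n -> dihedral_family H' n' ->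
  exists2 f : I -> I', injective f & forall i, n' (f i) = n i.
Proof.
move=> hH hH'.
have to' i : exists j, conj_in (H i) (H' j).
  by apply: (dih_conj hH'); [exact: (dih_group hH)|exact: (dih_finite hH)|exact: (dih_large hH)].
have back j : exists i, conj_in (H' j) (H i).
  by apply: (dih_conj hH); [exact: (dih_group hH')|exact: (dih_finite hH')|exact: (dih_large hH')].
have [f hf] := choice to'; have [b hb] := choice back.
have bf i : b (f i) = i by apply/esym/(dih_inj hH)/(conj_in_trans (hf i)).
exists f; first exact: can_inj bf.
move=> i; apply/eqP; rewrite eqn_leq (dihedral_le hH hH' (hf i)) andbT.
by have := dihedral_le hH' hH (hb (f i)); rewrite bf.
Qed.

End TwoFamilies.

Section Edges.
Variable C : coxsys.
Local Notation X := (gen C).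
Local Notation W := (grp C).
Local Notation g := (@gval C).
Local Notation m := (@cm C).
Implicit Types (s t u : X) (x y z : W) (J T : {set X}) (p : X * X).

(* Edges oriented by the enumeration of the generators. *)
Definition opairs (P : pred nat) : {set X * X} :=
  [set p | (enum_rank p.1 < enum_rank p.2)%N && oapp P false (m p.1 p.2)]%SET.
Definition lab p := odflt 0%N (m p.1 p.2).

Lemma opairsP P p : p \in opairs P -> [/\ p.1 != p.2, m p.1 p.2 = Some (lab p) & P (lab p)].
Proof.
rewrite inE /lab => /andP [h]; case: (m _ _) => //= n Pn; split=> //.
by apply: contraTneq h => ->; rewrite ltnn.
Qed.

Lemma opairs_total (P : pred nat) s t n : s != t -> m s t = Some n -> P n ->
  (s, t) \in opairs P \/ (t, s) \in opairs P.
Proof.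
move=> st mst Pn; rewrite !inE /= (cmC t) mst /= Pn !andbT.
have [|] := ltnP (enum_rank s) (enum_rank t); first by left.
rewrite leq_eqVlt => /orP [/eqP e|]; last by right.
by case/eqP: st; apply/enum_rank_inj/val_inj.
Qed.

Definition edge := {p : X * X | p \in opairs predT}.
Definition edge_set (e : edge) : {set X} := [set (val e).1; (val e).2]%SET.

Lemma edge_set_inj (p q : X * X) P Q : p \in opairs P -> q \in opairs Q ->
  [set p.1; p.2]%SET \subset [set q.1; q.2]%SET -> p = q.
Proof.
case: p q => [a b] [c d]; rewrite !inE /= => /andP [ab _] /andP [cd _] /fintype.subsetP h.
have := h a; have := h b; rewrite !inE !eqxx ?orbT => /(_ isT) hb /(_ isT) ha.
case/orP: ha hb => /eqP e /orP [] /eqP e'; rewrite e e' ?ltnn // in ab *.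
by have := ltn_trans ab cd; rewrite ltnn.
Qed.

Lemma para_group J : is_subgroup (para J).
Proof. by split; [exact: para1|exact: paraM|exact: paraV]. Qed.

Lemma conj_para_maxsph T T' x : maxsph T -> (forall y, para T y -> para T' (x^-1 * y * x)) ->
  T \subset T'.
Proof.
move=> mT h; suff [] : T \subset T' /\ para T' x^-1 by [].
apply: conj_maxsph => // t tT; apply: conj_spn; rewrite invgK.
exact/h/para_gval.
Qed.

Lemma edge_family : dim2 C ->
  dihedral_family (fun e : edge => para (edge_set e)) (fun e => lab (val e)).
Proof.
move=> hd; split.
- by move=> e; exact: para_group.
- by move=> [p pe]; have [st mst _] := opairsP pe; exact: edge_spherical mst.
- move=> [p pe]; have [st mst _] := opairsP pe; exists (g p.1), (g p.2).
  rewrite !gval_neq1 (inj_eq (@gval_inj C)); split=> //; apply: para_gval;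
    by rewrite !inE eqxx ?orbT.
- move=> F gF fF [a [b [Fa Fb a1 b1 ab]]].
  have [x [J [fJ hJ]]] := finite_conj_para gF fF.
  have cE c : c != 1 -> x^-1 * c * x != 1.
    by rewrite -mulgA -[x^-1 * _]/(c ^ x) conjg_eq1.
  have cab : x^-1 * a * x != x^-1 * b * x.
    by apply: contra ab => /eqP /mulIg /mulgI ->.
  have [J2|J2] := eqVneq #|J| 2%N.
    have /cards2P [s [t [st JE]]] : #|J| == 2%N by apply/eqP.
    have [n mst] : exists n, m s t = Some n by apply: spherical_edge; rewrite -?JE.
    have [h|h] := @opairs_total predT s t n st mst isT.
      by exists (exist _ (s, t) h), x => y Fy; rewrite /edge_set /= -JE; apply: hJ.
    by exists (exist _ (t, s) h), x => y Fy; rewrite /edge_set /= finset.setUC -JE; apply: hJ.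
  have [J1|J1] := eqVneq #|J| 1%N.
    have /cards1P [s JE] : #|J| == 1%N by apply/eqP.
    have cs c : F c -> c != 1 -> x^-1 * c * x = g s.
      move=> Fc /cE; rewrite JE in hJ; case: (para_set1 (hJ c Fc)) => // ->.
      by rewrite eqxx.
    by rewrite (cs a) // (cs b) // eqxx in cab.
  have : #|J| == 0 by have := hd _ fJ; lia.
  rewrite cards_eq0 => /eqP JE; rewrite JE in hJ.
  by have := cE a a1; rewrite (para0 (hJ a Fa)) eqxx.
- move=> e e' [x hx]; have [st mst _] := opairsP (valP e).
  have mT : maxsph (edge_set e) by apply: edge_maxsph mst.
  by apply/val_inj/(edge_set_inj (valP e) (valP e'))/(conj_para_maxsph mT hx).
- by move=> [p pe]; have [st mst _] := opairsP pe; exact: cm_ge2 mst.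
- move=> [p pe]; have [st mst _] := opairsP pe; exists (g p.1 * g p.2).
    by apply: paraM; apply: para_gval; rewrite !inE eqxx ?orbT.
  by move=> k; apply: edge_order.
move=> [p pe] y; have [st mst _] := opairsP pe; rewrite /edge_set /=.
case/(edge_elt st mst) => -[k ->]; last by right; exact: edge_refl2.
by left; rewrite -expgnA mulnC expgnA (braid_order mst) expg1n.
Qed.

End Edges.

(** * The groupoid of elements carrying simple roots to simple roots *)

Lemma pos_comb0 (a b p q : Rf) : (0 < a -> 0 < b -> 0 <= p -> 0 <= q ->
  a * p + b * q = 0 -> p = 0 /\ q = 0)%R.
Proof.
move=> a0 b0 p0 q0 /eqP; rewrite paddr_eq0 ?mulr_ge0 ?(ltW a0) ?(ltW b0) //.
rewrite !mulf_eq0 (gt_eqF a0) (gt_eqF b0) /=.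
by case/andP=> /eqP -> /eqP ->.
Qed.

Definition cj (W : groupType) (x a : W) := x * a * x^-1.

Section Cj.
Variable W : groupType.
Implicit Types x y a : W.
Lemma cjM x y a : cj (x * y) a = cj x (cj y a).
Proof. by rewrite /cj invgM !mulgA. Qed.
Lemma cj1 a : cj 1 a = a.
Proof. by rewrite /cj invg1 mulg1 mul1g. Qed.
Lemma cjK x a : cj x^-1 (cj x a) = a.
Proof. by rewrite -cjM mulVg cj1. Qed.
Lemma cj_eq x a b : cj x a = b <-> x * a = b * x.
Proof. by rewrite /cj; split=> [<-|->]; rewrite ?mulgVK ?mulgK. Qed.
End Cj.

Section Groupoid.
Variable C : coxsys.
Local Notation X := (gen C).
Local Notation W := (grp C).
Local Notation g := (@gval C).
Local Notation m := (@cm C).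
Local Notation vec := {ffun X -> Rf^o}.
Implicit Types (s t u : X) (x y z : W) (J T : {set X}).

Definition sends x s t := rho x (alpha s) = alpha t.

(** A reflection determines its root up to sign, and [g s] on the right switches the sign. *)
Lemma cj_sends x s t : cj x (g s) = g t -> sends x s t \/ sends (x * g s) s t.
Proof.
move=> e; set b := rho x (alpha s).
have rb : isroot b by exists x, s.
have e2 : 2 *: b = phi t b *: alpha t.
  have := rho_refl x s b; rewrite -/(cj x (g s)) e rho_gval -/b bf_root // /sigma.
  by move/addrI/oppr_inj => <-.
have line v : isroot v -> pos v -> v = b \/ v = - b -> v = alpha t.
  move=> rv pv vb; apply: root_line => // u ut.
  have : b u = 0r.
    have := congr1 (fun f : vec => f u) e2; rewrite !vecZ alphaE (negPf ut) mulr0 => /eqP.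
    by rewrite mulf_eq0 pnatr_eq0 => /eqP.
  by case: vb => ->; rewrite ?vecN => ->; rewrite ?oppr0.
have [nb|] := boolP (neg b); last first.
  by rewrite root_pos // => pb; left; apply: line => //; left.
have bE : rho (x * g s) (alpha s) = - b by rewrite rhoM rho_gval sigma_alphas linearN.
right; rewrite /sends bE; apply: line; [|by rewrite posN|by right].
by rewrite -bE; apply/root_rho/root_alpha.
Qed.

Lemma sends_cj x s t : sends x s t -> cj x (g s) = g t.
Proof.
move=> e; apply: rho_faithful => v; rewrite rho_refl e rho_gval.
by rewrite bf_alpha.
Qed.

Lemma sendsM x y s t u : sends y s t -> sends x t u -> sends (x * y) s u.
Proof. by rewrite /sends rhoM => ->. Qed.
Lemma sendsV x s t : sends x s t -> sends x^-1 t s.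
Proof. by rewrite /sends => <-; rewrite rhoK. Qed.
Lemma sends1 s : sends 1 s s. Proof. exact: rho1. Qed.
Lemma sends_desc x s t : sends x s t -> ~~ desc x s.
Proof. by move=> e; rewrite not_desc e pos_alpha. Qed.
Lemma sends_desc_neq x s t u : sends x s t -> desc x u -> s != u.
Proof. by move=> /sends_desc nd d; apply: contraNneq nd => ->. Qed.

(** For a finite label, the longest element of the dihedral parabolic subgroup times [g s]. For an
    infinite label [lab] is 0 and the word is empty. *)
Definition move s u := wprod (alt (lab (s, u)).-1 s u).
Definition target s u := if odd (lab (s, u)) then u else s.
Definition other s u := if odd (lab (s, u)) then s else u.

Lemma labC s u : lab (s, u) = lab (u, s). Proof. by rewrite /lab /= cmC. Qed.

Section Edge.
Variables (s u : X) (n : nat).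
Hypotheses (su : s != u) (msu : m s u = Some n).

Let labE : lab (s, u) = n. Proof. by rewrite /lab /= msu. Qed.
Let n2 : (2 <= n)%N. Proof. exact: cm_ge2 su msu. Qed.

Lemma move_sends : sends (move s u) s (target s u).
Proof.
rewrite /sends /move /target -[wprod _]mul1g rho_alt // !rho1 labE.
rewrite prednK ?(leq_trans _ n2) // /cwt msu cheb_kappa_n // cheb_kappa_pred //.
rewrite scale0r scale1r add0r; congr alpha.
have -> : odd n.-1 = ~~ odd n by lia.
by case: (odd n).
Qed.

Lemma target_target : target (target s u) (other s u) = s.
Proof. by rewrite /target /other; case h: (odd (lab (s, u))); rewrite /= ?(labC u) h. Qed.

Lemma moveV : move (target s u) (other s u) = (move s u)^-1.
Proof.
rewrite /move -wprod_rev rev_alt altl_alt /target /other !labE.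
have -> : odd n.-1 = ~~ odd n by lia.
by case: ifP => h; rewrite ?(labC u) labE.
Qed.

(* The last letter of [move s u] is [u], so [alpha u] is sent to the negative
   of a combination of [alpha (target s u)] and [alpha (other s u)]. *)
Lemma move_desc x t : sends x (target s u) t -> ~~ desc x (other s u) ->
  desc (x * move s u) u.
Proof.
move=> ex nd; have e : n.-1 = n.-2.+1 by lia.
have an : desc (move s u) u.
  rewrite /move labE e; apply: desc_alt => // k; rewrite msu => -[<-]; lia.
rewrite /desc rhoM; apply: neg_rho => // v; have [->|vt] := eqVneq v (target s u).
  by rewrite ex pos_alpha.
have [->|vo] := eqVneq v (other s u); first by rewrite -not_desc nd.
have : para [set s; u]%SET (move s u) by exists (alt (lab (s, u)).-1 s u); rewrite ?alt_sub.
have vsu : v \notin [set s; u]%SET.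
  move: vt vo; rewrite !inE /target /other; case: ifP => _ /negPf -> /negPf -> //.
have uin : u \in [set s; u]%SET by rewrite !inE eqxx orbT.
by move=> /spn_rho /(_ (spn_alpha uin)) /(_ v vsu) ->; rewrite eqxx.
Qed.

End Edge.

(** With [x = y * wprod (alt k s u)], the root [alpha t] is a combination of two positive roots with
    coefficients [cheb k.+1] and [cheb k]. If both were nonzero, the two roots would coincide with
    [alpha t]. Hence [cheb k.+1] vanishes, [k.+1] is the label, and the suffix is the whole move. *)
Lemma sends_strip x s t u : sends x s t -> desc x u ->
  [/\ exists n, m s u = Some n, sends (x * (move s u)^-1) (target s u) t &
      (len (x * (move s u)^-1) < len x)%N].
Proof.
move=> xst xu; have su := sends_desc_neq xst xu.
have xs := asc_len (sends_desc xst).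
have [y [k [xE xl [ys yu] kn k0]]] := alt_decomp su xs.
have {}k0 : (0 < k)%N by apply: k0; rewrite [in X in (_ < X)%N](desc_len xu).
have uk : (0 < cheb (cwt s u) k)%R by apply: cwt_cheb_gt0.
have uk1 : (0 <= cheb (cwt s u) k.+1)%R by apply: cwt_cheb_ge0.
have py v : v = s \/ v = u -> pos (rho y (alpha v)) by case=> ->; apply: pos_of_len.
have [n msu nk] : exists2 n, m s u = Some n & n = k.+1.
  have [h|h] := boolP (cheb (cwt s u) k.+1 == 0%R).
    have npos : (forall n, m s u = Some n -> (k.+1 < n)%N) -> False.
      by move=> hn; have := cwt_cheb_gt0 su hn isT; rewrite (eqP h) ltxx.
    case msu: (m s u) => [n|]; last by case: npos => n; rewrite msu.
    exists n => //; apply/eqP; rewrite eqn_leq kn // andbT leqNgt.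
    by apply/negP=> kn'; apply: npos => j; rewrite msu => -[<-].
  have {}uk1 : (0 < cheb (cwt s u) k.+1)%R by rewrite lt_neqAle eq_sym h.
  pose v1 := if odd k then u else s; pose v2 := if odd k then s else u.
  have p1 : pos (rho y (alpha v1)) by apply: py; rewrite /v1; case: ifP; [right|left].
  have p2 : pos (rho y (alpha v2)) by apply: py; rewrite /v2; case: ifP; [left|right].
  have coord (z : X) : z != t -> rho y (alpha v1) z = 0r /\ rho y (alpha v2) z = 0r.
    move=> zt; have := congr1 (fun f : vec => f z : Rf) xst.
    rewrite xE rho_alt // vecD !vecZ -/v1 -/v2 alphaE (negPf zt).
    exact: pos_comb0 uk1 uk (posP _ p1 z) (posP _ p2 z).
  have e1 : rho y (alpha v1) = alpha t.
    by apply: root_line => [||z /coord []] //; apply/root_rho/root_alpha.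
  have e2 : rho y (alpha v2) = alpha t.
    by apply: root_line => [||z /coord []] //; apply/root_rho/root_alpha.
  have : g v1 = g v2.
    have := sends_cj e1; rewrite -(sends_cj e2) => /(congr1 (cj y^-1)).
    by rewrite !cjK.
  by move/gval_inj; rewrite /v1 /v2; case: ifP => _ e; rewrite e eqxx in su.
have yE : y = x * (move s u)^-1.
  by rewrite xE /move /lab /= msu nk /= mulgK.
have ms := move_sends su msu.
split; first by exists n.
  exact: sendsM (sendsV ms) xst.
by rewrite -yE xl -addn1 leq_add2l.
Qed.

(* In the last case [x * g s] has the three descents [s], [u] and [u']. *)
Lemma sends_desc_uniq x s t u u' : dim2 C -> sends x s t -> desc x u -> desc x u' -> u = u'.
Proof.
move=> hd xst xu xu'; apply/eqP; apply: contraT => uu'.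
have su := sends_desc_neq xst xu; have su' := sends_desc_neq xst xu'.
have d v : s != v -> desc x v -> desc (x * g s) v.
  move=> sv xv; apply: contraT; rewrite not_desc => /posP p.
  have e : - rho x (alpha v) = alpha t.
    apply: root_line.
    - exists (x * g v), v; by rewrite rhoM rho_gval sigma_alphas linearN.
    - by rewrite posN.
    move=> z zt; have := p z; rewrite rhoM rho_gval sigma_alpha linearD linearZ /= xst.
    rewrite vecD vecZ alphaE (negPf zt) mulr0 addr0 vecN => pz.
    by apply/eqP; rewrite oppr_eq0 eq_le pz (neg_vecP _ xv).
  have /rho_inj : rho x (alpha s) = rho x (- alpha v) by rewrite xst linearN e.
  move/ffunP/(_ s); rewrite vecN !alphaE eqxx (negPf sv) oppr0 => /eqP.
  by rewrite oner_eq0.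
have : finite_set (para (s |: [set u; u'])%SET).
  apply: (@finite_para_desc _ _ (x * g s)) => v; rewrite !inE.
  case/or3P=> /eqP ->; [|exact: d|exact: d].
  by rewrite desc_mulr (sends_desc xst).
by move/hd; rewrite cardsU1 cards2 !inE negb_or su su' uu'.
Qed.

(* [mu] is the functor to [F] with value [y s u] on [move s u]; it is well defined
   because in dimension 2 the last move of a reduced factorization is unique. *)
Section Mu.
Variables (F : zmodType) (y : X -> X -> F).
Hypothesis hd : dim2 C.
Hypothesis yN : forall s u n, s != u -> m s u = Some n ->
  y (target s u) (other s u) = (- y s u)%R.

Fixpoint mu_rec k s x : F :=
  if k is k'.+1 then
    if [pick u | desc x u] is Some u
    then (y s u + mu_rec k' (target s u) (x * (move s u)^-1))%R else 0%R
  else 0%R.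

Definition mu s x := mu_rec (len x) s x.

Lemma mu_rec_fuel k k' s t x : sends x s t -> (len x <= k)%N -> (len x <= k')%N ->
  mu_rec k s x = mu_rec k' s x.
Proof.
have mu1 j s' : mu_rec j s' 1 = 0%R.
  case: j => //= j; case: pickP => // u.
  rewrite /desc rho1 => n; have := alpha_neq0 u.
  by rewrite (pos_neg0 (pos_alpha u) n) eqxx.
elim: k k' s x => [|k IH] k' s x xst.
  by rewrite leqn0 => /eqP /len_eq0 -> _; rewrite !mu1.
case: k' => [_|k']; first by rewrite leqn0 => /eqP /len_eq0 ->; rewrite !mu1.
move=> xk xk' /=; case: pickP => // u xu.
have [_ x' xl] := sends_strip xst xu; congr (_ + _)%R; apply: IH => //.
  by rewrite -ltnS (leq_trans xl).
by rewrite -ltnS (leq_trans xl).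
Qed.

Lemma mu1 s : mu s 1 = 0%R.
Proof. by rewrite /mu len1. Qed.

Lemma mu_desc s t u x : sends x s t -> desc x u ->
  mu s x = (y s u + mu (target s u) (x * (move s u)^-1))%R.
Proof.
move=> xst xu; have [_ x' xl] := sends_strip xst xu.
rewrite {1}/mu; case: (len x) xl => // k xl /=.
case: pickP => [u' xu'|/(_ u)]; last by rewrite xu.
rewrite (sends_desc_uniq hd xst xu' xu); congr (_ + _)%R.
exact: mu_rec_fuel x' _ _.
Qed.

(** The move either becomes the new last move or undoes the last move of [x]; in that case [yN]
    makes the two values cancel. *)
Lemma mu_move s t u n x : s != u -> m s u = Some n -> sends x (target s u) t ->
  mu s (x * move s u) = (mu (target s u) x + y s u)%R.
Proof.
move=> su msu xt; have ms := move_sends su msu.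
have [xo|xo] := boolP (desc x (other s u)).
  rewrite (mu_desc xt xo) (moveV su msu) invgK target_target (yN su msu).
  by rewrite addrAC addNr add0r.
rewrite (mu_desc (sendsM ms xt) (move_desc su msu xt xo)) mulgK.
by rewrite addrC.
Qed.

Lemma muM s t u x z : sends x s t -> sends z t u ->
  mu s (z * x) = (mu t z + mu s x)%R.
Proof.
have [n] := ubnP (len x); elim: n s x => // n IH s x xn xst zt.
have [x1|/exists_desc [v xv]] := eqVneq x 1.
  by move: xst; rewrite x1 mulg1 mu1 addr0 => /sends_cj; rewrite cj1 => /gval_inj ->.
have [[k msv] x' xl] := sends_strip xst xv; have sv := sends_desc_neq xst xv.
rewrite -[x](mulgVK (move s v)); set x1 := x * _^-1 in x' xl *.
rewrite mulgA (mu_move sv msv (sendsM x' zt)) (mu_move sv msv x').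
by rewrite (IH _ _ _ x' zt) ?addrA //; rewrite -ltnS (leq_trans _ xn).
Qed.

(** Extension of [mu] to the elements that conjugate [g s] to a generator, the factor [g s] having
    value 0. *)
Definition muh s x : F := if desc x s then mu s (x * g s) else mu s x.

Lemma muh_sends s t x : sends x s t -> muh s x = mu s x /\ muh s (x * g s) = mu s x.
Proof.
by move=> /sends_desc /negPf h; rewrite /muh h desc_mulr h -mulgA gval2 mulg1.
Qed.

Lemma muhM s t u x z : cj x (g s) = g t -> cj z (g t) = g u ->
  muh s (z * x) = (muh t z + muh s x)%R.
Proof.
have main x1 z1 : sends x1 s t -> sends z1 t u ->
  [/\ muh s (z1 * x1) = (mu t z1 + mu s x1)%R & muh s (z1 * x1 * g s) = (mu t z1 + mu s x1)%R].
  move=> hx hz; have [-> ->] := muh_sends (sendsM hx hz).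
  by rewrite (muM hx hz).
have red a b : a = b * g t -> forall x1, sends x1 s t -> a * x1 = b * x1 * g s.
  move=> -> x1 /sends_cj /cj_eq e; by rewrite -!mulgA e.
have gK a b : a = a * g b * g b by rewrite -mulgA gval2 mulg1.
move=> /cj_sends [hx|hx] /cj_sends [hz|hz].
- by have [-> _] := main _ _ hx hz; have [-> _] := muh_sends hx; have [-> _] := muh_sends hz.
- rewrite (red _ _ (gK z t) _ hx); have [_ ->] := main _ _ hx hz.
  have [_] := muh_sends hz; rewrite -gK => ->.
  by have [-> _] := muh_sends hx.
- have [_] := main _ _ hx hz; rewrite mulgA -gK => ->.
  have [_] := muh_sends hx; rewrite -gK => ->.
  by have [-> _] := muh_sends hz.
have e : z * g t * (x * g s) = z * x.
  by have /cj_eq e := sends_cj hx; rewrite -mulgA -e -gK.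
have [+ _] := main _ _ hx hz; rewrite e => ->.
have [_] := muh_sends hx; rewrite -gK => ->.
by have [_] := muh_sends hz; rewrite -gK => ->.
Qed.

End Mu.
End Groupoid.

(** * Cohomology of the conjugation action on involutions *)

Section Cocycles.
Variable W : groupType.
Implicit Types (x y a : W) (f : W -> 'F_3) (c : W -> W -> 'F_3).

Definition invol a := a != 1 /\ a ^+ 2 = 1.
Definition cocycle c := forall x y a, invol a -> c (x * y) a = (c x (cj y a) + c y a)%R.
Definition coboundary c := exists f, forall x a, invol a -> c x a = (f (cj x a) - f a)%R.
Definition conj_invariant f := forall x a, invol a -> f (cj x a) = f a.

Lemma invol_cj x a : invol a -> invol (cj x a).
Proof.
have -> : cj x a = a ^ x^-1 by rewrite conjgE invgK mulgA.
by move=> [a1 a2]; split; rewrite ?conjg_eq1 // -conjXg a2 conj1g.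
Qed.

Lemma cocycle1 c a : cocycle c -> invol a -> c 1 a = 0%R.
Proof.
move=> hc ia; have := hc 1 1 a ia; rewrite mulg1 cj1 => /eqP.
by rewrite -subr_eq0 opprD addNKr oppr_eq0 => /eqP.
Qed.

Lemma cocycleV c x a : cocycle c -> invol a -> c x^-1 (cj x a) = (- c x a)%R.
Proof.
move=> hc ia; apply/eqP; rewrite -addr_eq0 -hc // mulVg.
by rewrite cocycle1.
Qed.

(** The cocycle rule gives $2c=0$, and 2 is invertible in F_3. *)
Lemma cocycle_sqr c x a : cocycle c -> invol a -> x ^+ 2 = 1 -> cj x a = a -> c x a = 0%R.
Proof.
move=> hc ia x2 xa; have := hc x x a ia; rewrite -expg2 x2 cocycle1 // xa.
move: (c x a) => z /esym; case: z => -[|[|[|]]] //= i /(congr1 val) //= _.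
exact: val_inj.
Qed.

Lemma cocycleB c c' : cocycle c -> cocycle c' -> cocycle (fun x a => c x a - c' x a)%R.
Proof. by move=> hc hc' x y a ia; rewrite hc // hc' //; ring. Qed.

Lemma coboundary_cocycle f : cocycle (fun x a => f (cj x a) - f a)%R.
Proof. by move=> x y a ia; rewrite cjM; ring. Qed.

(* [D] computes the cohomology of the action: its kernel is H^0, and its cokernel
   is H^1 through evaluation of a cocycle at [mv b] and [base b]. *)
Record conj_complex (A B : finType) (rep : A -> W) (mv base : B -> W)
    (D : {ffun A -> ('F_3)^o} -> {ffun B -> ('F_3)^o}) : Prop := {
  cc_rep : forall i, invol (rep i);
  cc_inv : forall v, D v = 0%R -> exists2 f, conj_invariant f & forall i, f (rep i) = v i;
  cc_ker : forall f, conj_invariant f -> D [ffun i => f (rep i)] = 0%R;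
  cc_det : forall f f', conj_invariant f -> conj_invariant f' ->
    (forall i, f (rep i) = f' (rep i)) -> forall x, invol x -> f x = f' x;
  cc_surj : forall y : {ffun B -> ('F_3)^o},
    exists2 c, cocycle c & [ffun b => c (mv b) (base b)] = y;
  cc_bound : forall c, cocycle c ->
    ((exists v, D v = [ffun b => c (mv b) (base b)]) <-> coboundary c) }.

End Cocycles.

(** * The complex of a two-dimensional Coxeter system *)

Section Complex.
Variable C : coxsys.
Local Notation X := (gen C).
Local Notation W := (grp C).
Local Notation g := (@gval C).
Local Notation m := (@cm C).
Local Notation opairs := (@opairs C).
Implicit Types (s t u : X) (x y z w : W) (J T : {set X}).
Hypothesis hd : dim2 C.

Definition even_edge := {p : X * X | p \in opairs (fun n => ~~ odd n)}.
Definition odd_edge := {p : X * X | p \in opairs (fun n => odd n)}.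
Definition point := (X + even_edge)%type.

Definition center (p : X * X) : W := wprod (alt (lab p) p.1 p.2).
Definition prep (i : point) : W :=
  match i with inl s => g s | inr p => center (val p) end.

Definition odd_move (e : odd_edge) : W := move (val e).1 (val e).2.
Definition odd_base (e : odd_edge) : W := g (val e).1.
Definition edge_diff (v : {ffun point -> ('F_3)^o}) : {ffun odd_edge -> ('F_3)^o} :=
  [ffun e => v (inl (val e).2) - v (inl (val e).1)]%R.

Lemma edge_diff_linear : linear edge_diff.
Proof. by move=> a v w; apply/ffunP=> e; rewrite !ffunE scalerBr opprD addrACA. Qed.
HB.instance Definition _ := GRing.isLinear.Build _ _ _ _ edge_diff edge_diff_linear.

Lemma invol_gval s : invol (g s).
Proof. by split; [exact: gval_neq1 | rewrite expg2 gval2]. Qed.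

Section Even.
Variable p : X * X.
Hypothesis pe : p \in opairs (fun n => ~~ odd n).

Lemma center_neg s : s \in [set p.1; p.2]%SET -> rho (center p) (alpha s) = - alpha s.
Proof. by have [st mst on] := opairsP pe; apply: edge_center. Qed.

Lemma parity_center : parity (center p) = false.
Proof. by have [_ _ on] := opairsP pe; rewrite parity_wprod size_alt (negPf on). Qed.

Lemma center_rot : center p = (g p.1 * g p.2) ^+ (lab p)./2.
Proof.
have [_ _ on] := opairsP pe.
by rewrite /center -wprod_alt_double even_halfK.
Qed.

Lemma invol_center : invol (center p).
Proof.
have [st mst on] := opairsP pe; split.
  apply/eqP=> e; have := center_neg (s := p.1); rewrite e rho1 !inE eqxx => /(_ isT) h.
  have := alpha_neq0 p.1; rewrite (@pos_neg0 _ (alpha p.1)) ?eqxx ?pos_alpha //.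
  by rewrite h negN pos_alpha.
by rewrite center_rot -expgnA muln2 even_halfK // (braid_order mst).
Qed.

Lemma cj_center s : s \in [set p.1; p.2]%SET -> cj (g s) (center p) = center p.
Proof.
move=> sp; have e : cj (center p) (g s) = g s.
  apply: rho_faithful => v; rewrite rho_refl center_neg // rho_gval.
  have -> : bf v (- alpha s) = (- phi s v)%R.
    by rewrite -bf_alpha /bf -sumrN; apply: eq_bigr => t _; rewrite vecN mulNr.
  by rewrite scaleNr scalerN opprK.
by apply/cj_eq; apply/esym/cj_eq.
Qed.

(** [center q] acts as $-1$ on the image under [w] of the plane of [p], which places that image in
    the span of [q]; then [conj_maxsph] applies. *)
Lemma center_stab q w : q \in opairs (fun n => ~~ odd n) -> cj w (center p) = center q ->
  p = q /\ para [set q.1; q.2]%SET w.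
Proof.
move=> qe e; have [st mst _] := opairsP pe; have mT := edge_maxsph hd st mst.
have h t : t \in [set p.1; p.2]%SET -> spn [set q.1; q.2]%SET (rho w (alpha t)).
  move=> tp; set b := rho w (alpha t).
  have cb : rho (center q) b = - b.
    by rewrite -e /cj /b -rhoM mulgVK rhoM center_neg // linearN.
  have pc : para [set q.1; q.2]%SET (center q).
    by exists (alt (lab q) q.1 q.2); rewrite ?alt_sub.
  have := para_sub b pc; rewrite cb -opprD -mulr2n -scaler_nat => /(spnZ (- 2^-1)%R).
  by rewrite scalerN scalerA mulNr scaleNr opprK mulVf ?pnatr_eq0 // scale1r.
have [sub pw] := conj_maxsph mT h; split=> //.
exact: edge_set_inj pe qe sub.
Qed.

End Even.

(** Conjugation preserves parity, which separates the odd generators from the even central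
    involutions. *)
Lemma prep_conj w i j : cj w (prep i) = prep j ->
  (exists s t, [/\ i = inl s, j = inl t & cj w (g s) = g t]) \/
  (exists p : even_edge, [/\ i = inr p, j = inr p & para [set (val p).1; (val p).2]%SET w]).
Proof.
case: i j => [s|p] [t|q] /= e.
- by left; exists s, t.
- have := congr1 (@parity C) e; rewrite /cj !parityM parityV parity_gval.
  by rewrite (parity_center (valP q)); case: (parity w).
- have := congr1 (@parity C) e; rewrite /cj !parityM parityV parity_gval.
  by rewrite (parity_center (valP p)); case: (parity w).
have [pq pw] := center_stab (valP p) (valP q) e.
by right; exists q; split=> //; congr inr; apply: val_inj.
Qed.

Lemma invol_prep i : invol (prep i).
Proof. by case: i => [s|p] /=; [exact: invol_gval | exact: invol_center (valP p)]. Qed.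

Lemma prep_surj a : invol a -> exists z : W * point, a = cj z.1 (prep z.2).
Proof.
move=> [a1 a2]; have [[s [y e]]|[s [t [n [y [st mst on e]]]]]] := involution_cases hd a1 a2.
  by exists (y, inl s).
have nE : n = lab (s, t) by rewrite /lab /= mst.
have [h|h] := @opairs_total _ (fun n => ~~ odd n) s t n st mst on.
  by exists (y, inr (exist _ (s, t) h)); rewrite /= e nE.
exists (y, inr (exist _ (t, s) h)).
by rewrite /= e (wprod_altC mst) nE labC.
Qed.

Lemma odd_edgeP (e : odd_edge) : let: (s, t) := val e in
  [/\ s != t, m s t = Some (lab (s, t)), target s t = t & other s t = s].
Proof.
case: e => -[s t] /= h; have [/= st mst on] := opairsP h.
by split=> //; rewrite /target /other on.
Qed.

Lemma sends_transport (v : {ffun point -> ('F_3)^o}) w s t : edge_diff v = 0%R ->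
  sends w s t -> v (inl s) = v (inl t).
Proof.
move=> v0; have vo s' t' : s' != t' -> m s' t' = Some (lab (s', t')) -> odd (lab (s', t')) ->
    v (inl s') = v (inl t').
  move=> st mst on.
  have E (p : X * X) (h : p \in opairs (fun n => odd n)) : v (inl p.1) = v (inl p.2).
    have := congr1 (fun y : {ffun _ -> _} => y (exist _ p h)) v0; rewrite !ffunE /= => /eqP.
    by rewrite subr_eq0 => /eqP.
  by have [/E|/E] := @opairs_total _ (fun n => odd n) s' t' _ st mst on.
have [n] := ubnP (len w); elim: n s w => // n IH s w wn wst.
have [w1|/exists_desc [u wu]] := eqVneq w 1.
  by move: wst; rewrite w1 => /sends_cj; rewrite cj1 => /gval_inj ->.
have [[k msu] w' wl] := sends_strip wst wu; have su := sends_desc_neq wst wu.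
rewrite -(IH _ _ _ w'); last by rewrite -ltnS (leq_trans _ wn).
rewrite /target; case: ifP => // on; apply: vo => //.
by rewrite /lab /= msu.
Qed.

Lemma point_transport (v : {ffun point -> ('F_3)^o}) w i j : edge_diff v = 0%R ->
  cj w (prep i) = prep j -> v i = v j.
Proof.
move=> v0 /prep_conj [[s [t [-> -> /cj_sends]]]|[p [-> -> _]]] //.
by case; apply: sends_transport.
Qed.

Definition choose_prep a : option (W * point) :=
  if pselect (exists z : W * point, a = cj z.1 (prep z.2)) is left H
  then Some (sval (cid H)) else None.

Lemma choose_prepP a : invol a -> exists2 z, choose_prep a = Some z & a = cj z.1 (prep z.2).
Proof.
move=> /prep_surj h; rewrite /choose_prep; case: pselect => // H.
by exists (sval (cid H)) => //; case: cid.
Qed.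

Lemma invariant_ex v : edge_diff v = 0%R ->
  exists2 f, conj_invariant f & forall i, f (prep i) = v i.
Proof.
move=> v0; pose f a : 'F_3 := if choose_prep a is Some z then v z.2 else 0%R.
have fE w i : f (cj w (prep i)) = v i.
  rewrite /f; have [z -> e] := choose_prepP (invol_cj w (invol_prep i)).
  apply/esym; apply: (@point_transport _ (z.1^-1 * w)) => //.
  by rewrite cjM e cjK.
exists f => [x a ia|i]; last by rewrite -(fE 1 i) cj1.
by have [z _ ->] := choose_prepP ia; rewrite -cjM !fE.
Qed.

(** Vanishing on the moves implies vanishing on every element that conjugates one representative to
    another. Then [c z (prep i)] depends only on the involution [cj z (prep i)], and is a potential
    for [c]. *)
Lemma cocycle_trivial c : cocycle c -> (forall e, c (odd_move e) (odd_base e) = 0%R) ->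
  coboundary c.
Proof.
move=> hc c0.
have c_move s u n : s != u -> m s u = Some n -> c (move s u) (g s) = 0%R.
  move=> su msu; have ms := move_sends su msu; have nE : n = lab (s, u) by rewrite /lab /= msu.
  have [on|en] := boolP (odd n).
    have [h|h] := @opairs_total _ (fun n => odd n) s u n su msu on.
      exact: (c0 (exist _ (s, u) h : odd_edge)).
    have tE : target s u = u by rewrite /target -nE on.
    have oE : other s u = s by rewrite /other -nE on.
    have := c0 (exist _ (u, s) h : odd_edge); rewrite /odd_move /odd_base /=.
    have := moveV su msu; rewrite tE oE => ->.
    have := sends_cj ms; rewrite tE => <-; rewrite (cocycleV _ hc (invol_gval s)) => /eqP.
    by rewrite oppr_eq0 => /eqP.
  have tE : target s u = s by rewrite /target -nE (negPf en).
  have oE : other s u = u by rewrite /other -nE (negPf en).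
  (* For an even label [moveV] says that the move is its own inverse, and it fixes [g s]. *)
  apply: (cocycle_sqr hc (invol_gval s)); last by rewrite (sends_cj ms) tE.
  have := moveV su msu; rewrite tE oE => e.
  by rewrite expg2 {2}e mulgV.
have c_sends w s t : sends w s t -> c w (g s) = 0%R.
  have [n] := ubnP (len w); elim: n s w => // n IH s w wn wst.
  have [->|/exists_desc [u wu]] := eqVneq w 1; first by rewrite (cocycle1 hc (invol_gval s)).
  have [[k msu] w' wl] := sends_strip wst wu; have su := sends_desc_neq wst wu.
  rewrite -[w](mulgVK (move s u)) hc; last exact: invol_gval.
  rewrite (c_move _ _ _ su msu) addr0 (sends_cj (move_sends su msu)).
  by apply: IH w'; rewrite -ltnS (leq_trans _ wn).
have c_cj w i j : cj w (prep i) = prep j -> c w (prep i) = 0%R.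
  move=> /prep_conj [[s [t [-> _ /cj_sends [/c_sends//|h]]]]|[p [-> _ [us + <-]]]] /=.
    rewrite -[w](mulgVK (g s)) gvalV hc; last exact: invol_gval.
    have -> : cj (g s) (g s) = g s by rewrite /cj mulgK.
    rewrite (c_sends _ _ _ h) add0r; apply: (cocycle_sqr hc (invol_gval s)).
      by rewrite expg2 gval2.
    by rewrite /cj mulgK.
  have ip := invol_center (valP p).
  elim: us => [|s us IH] /=; first by rewrite wprod_nil (cocycle1 hc ip).
  move=> /andP [sp usp]; rewrite wprod_cons hc // (IH usp) addr0.
  have -> : cj (wprod us) (center (val p)) = center (val p).
    elim: us usp {IH} => [|s' us IH] /=; first by rewrite wprod_nil cj1.
    by case/andP=> sp' /IH e; rewrite wprod_cons cjM e (cj_center (valP p)).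
  apply: (cocycle_sqr hc ip); first by rewrite expg2 gval2.
  by apply: (cj_center (valP p)); exact: sp.
pose f a : 'F_3 := if choose_prep a is Some z then c z.1 (prep z.2) else 0%R.
have fE w i : f (cj w (prep i)) = c w (prep i).
  rewrite /f; have [[z j] -> /= e] := choose_prepP (invol_cj w (invol_prep i)).
  have zj : cj (z^-1 * w) (prep i) = prep j by rewrite cjM e cjK.
  rewrite -[w in RHS](mulVKg z) hc; last exact: invol_prep.
  by rewrite zj (c_cj _ _ _ zj) addr0.
exists f => x a ia; have [[z i] _ ->] := choose_prepP ia.
rewrite -cjM !fE hc; last exact: invol_prep.
by rewrite addrK.
Qed.

(** * Cocycles with prescribed values on the odd edges *)

Section Realize.
Variable y : {ffun odd_edge -> ('F_3)^o}.

(** The antisymmetric extension of [y] to both orientations, zero elsewhere, as [mu] requires. *)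
Definition edge_val s u : 'F_3 :=
  match insub (s, u) : option odd_edge, insub (u, s) : option odd_edge with
  | Some e, _ => y e
  | None, Some e => (- y e)%R
  | None, None => 0%R
  end.

Lemma edge_val_odd (e : odd_edge) : edge_val (val e).1 (val e).2 = y e.
Proof. by case: e => -[s t] h; rewrite /edge_val /= insubT. Qed.

Lemma edge_valN s u n : s != u -> m s u = Some n ->
  edge_val (target s u) (other s u) = (- edge_val s u)%R.
Proof.
move=> su msu; have nE : lab (s, u) = n by rewrite /lab /= msu.
rewrite /target /other nE; case: ifP => on; rewrite /edge_val.
  case: insubP => [[[a b] /= hab] h /= e1|h1]; case: insubP => [[[a' b'] /= hab'] h' /= e2|h2].
  - move: h h'; rewrite !inE /= => /andP [h _] /andP [h' _].
    by have := ltn_trans h h'; rewrite ltnn.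
  - by rewrite opprK.
  - by [].
  by have [h|h] := @opairs_total _ (fun n => odd n) s u n su msu on; rewrite h in h1 h2.
have notodd : (s, u) \notin opairs (fun n => odd n).
  by apply/negP=> h; have [_ _] := opairsP h; rewrite nE on.
have notodd' : (u, s) \notin opairs (fun n => odd n).
  by apply/negP=> h; have [_ _] := opairsP h; rewrite labC nE on.
by rewrite !insubN // oppr0.
Qed.

(* Trivializes the groupoid over the conjugates of the generators; the first case
   makes the trivialization the identity at the generators themselves. *)
Definition refl_base a : option (W * X) :=
  if [pick s | g s == a] is Some s then Some (1, s)
  else if pselect (exists z : W * X, a = cj z.1 (g z.2)) is left H
  then Some (sval (cid H)) else None.

Lemma refl_base_gval s : refl_base (g s) = Some (1, s).
Proof.
rewrite /refl_base; case: pickP => [s' /eqP /gval_inj -> //|/(_ s)].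
by rewrite eqxx.
Qed.

Lemma refl_baseP a (z : W * X) : refl_base a = Some z -> a = cj z.1 (g z.2).
Proof.
rewrite /refl_base; case: pickP => [s /eqP <- [<-]|_]; first by rewrite cj1.
by case: pselect => // H [<-]; case: cid.
Qed.

Lemma refl_base_cj x a : refl_base (cj x a) = None -> refl_base a = None.
Proof.
case E: (refl_base a) => [z|] //; have := refl_baseP E => aE.
rewrite /refl_base; case: pickP => // _; case: pselect => // -[].
by exists (x * z.1, z.2); rewrite cjM -aE.
Qed.

(** The functor [muh] read through the trivialization; involutions not conjugate to a generator
    receive 0. *)
Definition realize x a : 'F_3 :=
  match refl_base a, refl_base (cj x a) with
  | Some z, Some z' => muh edge_val z.2 (z'.1^-1 * x * z.1)
  | _, _ => 0%R
  end.

Lemma realize_cocycle : cocycle realize.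
Proof.
move=> x x' a _; rewrite /realize cjM.
case E0: (refl_base a) => [z0|]; last first.
  case E1: (refl_base (cj x' a)) => [z1|]; last by rewrite addr0.
  have := @refl_base_cj x'^-1 (cj x' a); rewrite cjK E1 => /(_ E0) //.
case E1: (refl_base (cj x' a)) => [z1|]; last by rewrite (refl_base_cj E1) in E0.
case E2: (refl_base (cj x (cj x' a))) => [z2|]; last by rewrite (refl_base_cj E2) in E1.
have e0 := refl_baseP E0; have e1 := refl_baseP E1; have e2 := refl_baseP E2.
have -> : z2.1^-1 * (x * x') * z0.1 = (z2.1^-1 * x * z1.1) * (z1.1^-1 * x' * z0.1).
  by rewrite !mulgA mulgK.
apply: (muhM hd edge_valN (t := z1.2) (u := z2.2)).
  by rewrite !cjM -e0 e1 cjK.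
by rewrite !cjM -e1 e2 cjK.
Qed.

Lemma realize_edge : [ffun e => realize (odd_move e) (odd_base e)] = y.
Proof.
apply/ffunP=> e; rewrite ffunE /realize /odd_base /odd_move.
have := odd_edgeP e; have := edge_val_odd e; case: (val e) => s t /= yE [st mst tE oE].
have ms := move_sends st mst; rewrite refl_base_gval (sends_cj ms) tE refl_base_gval /=.
rewrite invg1 mul1g mulg1; have [-> _] := muh_sends edge_val ms.
rewrite -[move s t]mul1g (mu_move hd edge_valN st mst (sends1 _)) mu1 add0r yE //.
Qed.

End Realize.

Lemma coxeter_complex : conj_complex prep odd_move odd_base edge_diff.
Proof.
split.
- exact: invol_prep.
- exact: invariant_ex.
- move=> f hf; apply/ffunP=> e; rewrite !ffunE /=.
  have := odd_edgeP e; case: e => -[s t] h0 /= [st mst tE oE].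
  have := sends_cj (move_sends st mst); rewrite tE => <-.
  by rewrite (hf _ _ (invol_gval s)) subrr.
- move=> f f' hf hf' e x ix; have [z _ ->] := choose_prepP ix.
  by rewrite (hf _ _ (invol_prep _)) (hf' _ _ (invol_prep _)).
- by move=> y; exists (realize y); [exact: realize_cocycle | exact: realize_edge].
move=> c hc; split=> [[v vE]|[f fE]]; last first.
  exists [ffun i => f (prep i)]; apply/ffunP=> e; rewrite !ffunE /= /odd_move /odd_base.
  have := odd_edgeP e; case: e => -[s t] h0 /= [st mst tE oE].
  by rewrite (fE _ _ (invol_gval s)) (sends_cj (move_sends st mst)) tE.
(* The coboundary of [f] agrees with [c] on the odd moves, so the difference falls under
   [cocycle_trivial]. *)
pose f a : 'F_3 := if [pick s | g s == a] is Some s then v (inl s) else 0%R.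
have fs s : f (g s) = v (inl s).
  rewrite /f; case: pickP => [s' /eqP /gval_inj -> //|/(_ s)].
  by rewrite eqxx.
have [|h hE] := @cocycle_trivial _ (cocycleB hc (coboundary_cocycle f)).
  move=> e; have := congr1 (fun y : {ffun _ -> _} => y e) vE; rewrite !ffunE => <-.
  rewrite /odd_move /odd_base.
  have := odd_edgeP e; case: e => -[s t] h0 /= [st mst tE oE].
  by rewrite (sends_cj (move_sends st mst)) tE !fs subrr.
exists (fun a => h a + f a)%R => x a ia.
by have /eqP := hE x a ia; rewrite subr_eq => /eqP ->; ring.
Qed.

End Complex.

(** * Comparison of two Coxeter systems *)

(** Over a finite field the cardinality determines the dimension, so an injection suffices, linear
    or not. *)
Lemma leq_dimv_inj (F : finFieldType) (V V' : vectType F) (U : {vspace V}) (U' : {vspace V'})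
    (f : V -> V') :
  (forall v, v \in U -> f v \in U') -> {in U &, injective f} -> (\dim U <= \dim U')%N.
Proof.
move=> fU f_inj.
pose h (r : 'rV[F]_(\dim U)) : 'rV[F]_(\dim U') :=
  @VectorInternalTheory.v2r _ (subvs_of U')
    (vsproj U' (f (vsval (@VectorInternalTheory.r2v _ (subvs_of U) r)))).
have h_inj : injective h.
  move=> r r'; rewrite /h.
  move=> /(@VectorInternalTheory.v2r_inj _ (subvs_of U')) /(congr1 (@vsval _ _ U')).
  rewrite !vsprojK ?fU ?subvsP // => /f_inj; rewrite !subvsP => /(_ isT isT) /val_inj.
  exact: VectorInternalTheory.r2v_inj.
have := leq_card h h_inj; rewrite !card_mx !mul1n leq_exp2l //.
by apply/card_gt1P; exists 0%R, 1%R; rewrite eq_sym oner_eq0.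
Qed.

Section CompareComplexes.
Variables (W : groupType) (A B A' B' : finType).
Variables (rep : A -> W) (mv base : B -> W) (rep' : A' -> W) (mv' base' : B' -> W).
Variables (D : {linear {ffun A -> ('F_3)^o} -> {ffun B -> ('F_3)^o}}).
Variables (D' : {linear {ffun A' -> ('F_3)^o} -> {ffun B' -> ('F_3)^o}}).
Hypotheses (cc : conj_complex rep mv base D) (cc' : conj_complex rep' mv' base' D').

Lemma leq_dim_ker : (\dim (lker (linfun D)) <= \dim (lker (linfun D')))%N.
Proof.
have ex v : exists f : W -> 'F_3, v \in lker (linfun D) ->
    conj_invariant f /\ forall i, f (rep i) = v i.
  have [/eqP|] := boolP (D v == 0%R); last first.
    by rewrite memv_ker lfunE => /negPf ->; exists (fun=> 0%R).
  by move/(cc_inv cc) => [f hf fv]; exists f.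
have [F hF] := choice ex.
apply: (@leq_dimv_inj _ _ _ _ _ (fun v => [ffun i => F v (rep' i)] : {ffun A' -> ('F_3)^o})).
  move=> v /hF [hv _]; rewrite memv_ker lfunE /=.
  by rewrite (cc_ker cc' hv).
move=> v v' /hF [hv vE] /hF [hv' vE'] /ffunP e; apply/ffunP=> i.
rewrite -vE -vE'; apply: (cc_det cc' hv hv'); last exact: (cc_rep cc).
by move=> i'; have := e i'; rewrite !ffunE.
Qed.

(** The cokernel is modelled on a complement of the image. A vector is lifted to a cocycle and
    evaluated in the other complex modulo the image there; equal results make the difference a
    coboundary, a notion that refers to neither complex. *)
Lemma leq_dim_coker : (\dim ((limg (linfun D))^C) <= \dim ((limg (linfun D'))^C))%N.
Proof.
pose psi c : {ffun B -> ('F_3)^o} := [ffun b => c (mv b) (base b)].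
pose psi' c : {ffun B' -> ('F_3)^o} := [ffun b => c (mv' b) (base' b)].
have ex y : exists c : W -> W -> 'F_3, cocycle c /\ psi c = y.
  by have [c] := cc_surj cc y; exists c.
have [c hc] := choice ex.
set I := limg _; set I' := limg _.
apply: (@leq_dimv_inj _ _ _ _ _ (fun y => daddv_pi I'^C I' (psi' (c y)))).
  by move=> y _; apply: memv_pi.
move=> y y' yI y'I e; have [cy yE] := hc y; have [cy' yE'] := hc y'.
pose d x a := (c y x a - c y' x a)%R; have cd : cocycle d by apply: cocycleB.
have dE : psi d = (y - y')%R by rewrite -[in RHS]yE -[in RHS]yE'; apply/ffunP=> b; rewrite !ffunE.
have dE' : psi' d = (psi' (c y) - psi' (c y'))%R by apply/ffunP=> b; rewrite !ffunE.
have inI' : psi' d \in I'.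
  have cap : (I'^C :&: I' = 0)%VS by rewrite capvC capv_compl.
  have := daddv_pi_add cap (w := psi' d); rewrite addvC addv_complf memvf => /(_ isT).
  rewrite {1}dE' linearB /= e subrr add0r => <-; exact: memv_pi.
have bd : coboundary d.
  apply/(cc_bound cc' cd); have /memv_imgP [v _ vE] := inI'.
  by exists v; rewrite -[RHS]/(psi' d) vE lfunE.
have [v vE] := proj2 (cc_bound cc cd) bd.
have inI : (y - y')%R \in I.
  by apply/memv_imgP; exists v; rewrite ?memvf // lfunE /= vE -dE.
have : (y - y')%R \in (I :&: I^C)%VS by rewrite memv_cap inI rpredB.
by rewrite capv_compl memv0 subr_eq0 => /eqP.
Qed.

End CompareComplexes.

Lemma dim_ffun (A : finType) : \dim {: {ffun A -> ('F_3)^o}} = #|A|.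
Proof. by rewrite dimvf; exact: muln1. Qed.

(** By rank-nullity $|A|-|B|$ is the dimension of the kernel minus that of the cokernel, and both
    agree for the two complexes. *)
Lemma complex_card (W : groupType) (A B A' B' : finType)
    (rep : A -> W) (mv base : B -> W) (rep' : A' -> W) (mv' base' : B' -> W)
    (D : {linear {ffun A -> ('F_3)^o} -> {ffun B -> ('F_3)^o}})
    (D' : {linear {ffun A' -> ('F_3)^o} -> {ffun B' -> ('F_3)^o}}) :
  conj_complex rep mv base D -> conj_complex rep' mv' base' D' ->
  (#|A| + #|B'| = #|A'| + #|B|)%N.
Proof.
move=> cc cc'.
have k1 := leq_dim_ker cc cc'; have k2 := leq_dim_ker cc' cc.
have c1 := leq_dim_coker cc cc'; have c2 := leq_dim_coker cc' cc.
have r := limg_ker_dim (linfun D) fullv; rewrite capfv dim_ffun in r.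
have r' := limg_ker_dim (linfun D') fullv; rewrite capfv dim_ffun in r'.
rewrite !dimv_compl !dim_ffun in c1 c2.
have l := dimvS (subvf (limg (linfun D))); rewrite dim_ffun in l.
have l' := dimvS (subvf (limg (linfun D'))); rewrite dim_ffun in l'.
lia.
Qed.

(** * Translation from Davis-Vinberg complexes and Coxeter diagrams *)

Section Interface.
Variables (W : groupType) (S : {fset W}) (m : S -> S -> option nat).
Hypothesis hS : coxeter_system m.

Definition fset_coxsys : coxsys :=
  @CoxSys S W (fun s : S => val s) m (proj1 hS) (proj2 hS).
Local Notation C := fset_coxsys.

Let span (us : seq S) : set W := generated [set` [fset x in [seq val s | s <- us]]%fset].

Let span_para (us : seq S) : span us `<=` @para C [set s in us]%SET.
Proof.
apply: smallest_sub; first exact: (@para_group C).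
move=> x /=; rewrite inE /= => /mapP [s sus ->].
by apply: (@para_gval C); rewrite inE.
Qed.

Let span_gen (us : seq S) s : s \in us -> span us (val s).
Proof. by move=> h; apply: sub_gen_smallest; rewrite /= inE; apply: map_f. Qed.

Let span_sub (us vs : seq S) : {subset us <= vs} -> span us `<=` span vs.
Proof.
move=> h; apply: sub_smallest2r.
  split=> [A [[]]//|x y hx hy A [gA sA]|x hx A [gA sA]].
    by case: (gA) => _ + _; apply; [apply: hx|apply: hy].
  by case: (gA) => _ _; apply; apply: hx.
move=> x /=; rewrite !inE => /mapP [s /h sv ->]; exact: map_f.
Qed.

Let span_neq (us vs : seq S) s : s \in vs -> s \notin us -> span us <> span vs.
Proof.
move=> sv su e; case/negP: su.
have := span_gen sv; rewrite -e => /span_para /(@para_gvalP C).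
by rewrite inE.
Qed.

Let span_coset (J : {set S}) (us : seq S) : finite_set (@para C J) -> {subset us <= J} ->
  spherical_cosets S (span us).
Proof.
move=> fJ h; exists 1, [fset x in [seq val s | s <- us]]%fset; split.
- by apply/fsubsetP=> x; rewrite inE => /mapP [s _ ->]; exact: valP.
- apply: sub_finite_set fJ; apply: subset_trans (@span_para us) _.
  by apply: (@paraS C); apply/fintype.subsetP=> s; rewrite inE; exact: h.
apply/seteqP; split=> [x hx|x [y hy <-]]; last by rewrite mul1g.
by exists x => //; rewrite mul1g.
Qed.

(** Three generators of a finite parabolic subgroup would give a chain of four spherical cosets, the
    subgroups generated by the first 0, 1, 2 and 3 of them. *)
Lemma davis_dim2 : davis_vinberg_dim S 2 -> dim2 C.
Proof.
move=> [_ hmax] J fJ; rewrite leqNgt; apply/negP=> /card_gt2P [s [t [u [[sJ tJ uJ] [st tu us]]]]].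
pose c := [fset A in [:: span [::]; span [:: s]; span [:: s; t]; span [:: s; t; u]]]%fset.
have sub1 : {subset [::] <= [:: s]} by [].
have sub2 : {subset [:: s] <= [:: s; t]} by move=> x; rewrite !inE => ->.
have sub3 : {subset [:: s; t] <= [:: s; t; u]}.
  by move=> x; rewrite !inE => /orP [] ->; rewrite ?orbT.
have card_c : #|` c|%fset = 4.
  have su : u \notin [:: s; t] by rewrite !inE negb_or us eq_sym tu.
  have e0 vs : s \in vs -> span [::] <> span vs by move=> h; apply: (span_neq h).
  have e1 vs : t \in vs -> span [:: s] <> span vs.
    by move=> h; apply: (span_neq h); rewrite inE eq_sym.
  have e2 : span [:: s; t] <> span [:: s; t; u].
    by apply: (span_neq (s := u)) su; rewrite !inE eqxx !orbT.
  rewrite card_fseq undup_id // !cons_uniq !in_cons !in_nil !negb_or.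
  do ![apply/andP; split] => //; case: pselect => // h.
  - by case: (e0 _ _ h); rewrite inE.
  - by case: (e0 _ _ h); rewrite inE eqxx.
  - by case: (e0 _ _ h); rewrite inE eqxx.
  - by case: (e1 _ _ h); rewrite !inE eqxx orbT.
  - by case: (e1 _ _ h); rewrite !inE eqxx orbT.
have cP A : A \in c ->
    [\/ A = span [::], A = span [:: s], A = span [:: s; t] | A = span [:: s; t; u]].
  rewrite !inE ?orbF => /or4P [] /eqP ->; first exact: Or41; first exact: Or42.
    exact: Or43.
  exact: Or44.
have : simplex (spherical_cosets S) c.
  split.
  - by rewrite -cardfs_gt0 card_c.
  - have inJ : {subset [:: s; t; u] <= J} by move=> x; rewrite !inE => /or3P [] /eqP ->.
    by move=> A /cP [] ->; apply: (span_coset fJ) => x hx; apply: inJ;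
      [apply/sub3/sub2/sub1 | apply/sub3/sub2 | apply/sub3 | ].
  have s1 := span_sub sub1; have s2 := span_sub sub2; have s3 := span_sub sub3.
  have s12 := subset_trans s1 s2; have s23 := subset_trans s2 s3.
  have s13 := subset_trans s12 s3.
  by move=> A B /cP [] -> /cP [] ->; first [by left | by right].
by move/hmax; rewrite card_c.
Qed.

Local Notation opairs := (@opairs C).

Lemma coxeter_edgesE : coxeter_edges m = [set [set p.1; p.2]%SET | p in opairs predT]%SET.
Proof.
apply/setP=> e; apply/imsetP/imsetP => -[[s t] /=].
  rewrite inE /= => /andP [st]; case mst: (m s t) => [n|] // _ ->.
  have [h|h] := @opairs_total C predT s t n st mst isT; first by exists (s, t).
  by exists (t, s) => //; rewrite finset.setUC.
move=> /(@opairsP C) [st mst _] ->; exists (s, t) => //=.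
by rewrite inE /= st; move: mst => /= ->.
Qed.

Lemma edge_labelE p : p \in opairs predT -> edge_label m [set p.1; p.2]%SET = @lab C p.
Proof.
move=> pe; have [st mst _] := @opairsP C _ _ pe; rewrite /edge_label.
case: pickP => [[a b] /= /eqP e|/(_ p)]; last by rewrite eqxx.
have ha : a \in [set p.1; p.2]%SET by rewrite e !inE eqxx.
have hb : b \in [set p.1; p.2]%SET by rewrite e !inE eqxx orbT.
have ab : a != b.
  apply: contra st => /eqP ab; have h1 : p.1 \in [set a; b]%SET by rewrite -e !inE eqxx.
  have h2 : p.2 \in [set a; b]%SET by rewrite -e !inE eqxx orbT.
  by move: h1 h2; rewrite ab !inE !orbb => /eqP -> /eqP ->.
rewrite /lab; move: ha hb ab; rewrite !inE => /orP [] /eqP -> /orP [] /eqP ->; rewrite ?eqxx // => _.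
by congr odflt; exact: (@cmC C).
Qed.

Lemma perm_edge_labels :
  perm_eq [seq edge_label m e | e <- enum (coxeter_edges m)]
    [seq @lab C p | p <- enum (opairs predT)].
Proof.
have pe : perm_eq (enum (coxeter_edges m)) [seq [set p.1; p.2]%SET | p <- enum (opairs predT)].
  apply: uniq_perm; first exact: enum_uniq.
    rewrite map_inj_in_uniq ?enum_uniq // => p q; rewrite !mem_enum => hp hq e.
    by apply: edge_set_inj hp hq _; rewrite e.
  move=> e; rewrite mem_enum coxeter_edgesE; apply/imsetP/mapP => -[p hp ->]; exists p => //.
    by rewrite mem_enum.
  by rewrite mem_enum in hp.
apply: perm_trans (perm_map _ pe) _; rewrite -map_comp.
by rewrite (@eq_in_map _ _ _ (@lab C) _).1 // => p; rewrite mem_enum => /edge_labelE.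
Qed.

Lemma card_coxeter_edges : #|coxeter_edges m| = #|opairs predT|.
Proof. by have := perm_size perm_edge_labels; rewrite !size_map -!cardE. Qed.

Lemma card_opairs (P : pred nat) :
  #|opairs P| = count P [seq @lab C p | p <- enum (opairs predT)].
Proof.
rewrite count_map -size_filter cardE; apply: perm_size; apply: uniq_perm.
- exact: enum_uniq.
- exact/filter_uniq/enum_uniq.
move=> p; rewrite mem_enum [RHS]mem_filter mem_enum /= !inE /lab.
by case: (cm _ _) => [n|] /=; rewrite ?andbF // andbT andbC.
Qed.

End Interface.

(** With equal cardinalities the injection is a bijection of edges, so it matches the two lists of
    labels. *)
Lemma perm_labels_sub (C C' : coxsys) (f : edge C -> edge C') : injective f ->
  (forall e, lab (val (f e)) = lab (val e)) -> #|{: edge C}| = #|{: edge C'}| ->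
  perm_eq [seq lab p | p <- enum (opairs C predT)]
    [seq lab p | p <- enum (opairs C' predT)].
Proof.
move=> f_inj fl cE.
have valE (D : coxsys) : perm_eq (enum (opairs D predT)) [seq val e | e <- enum {: edge D}].
  apply: uniq_perm; rewrite ?(map_inj_uniq val_inj) ?enum_uniq // => p; rewrite mem_enum.
  apply/idP/mapP => [h|[e _ ->]]; last exact: valP.
  by exists (exist _ p h : edge D); rewrite ?mem_enum.
have fE : perm_eq (enum {: edge C'}) [seq f e | e <- enum {: edge C}].
  rewrite perm_sym; apply: uniq_perm; rewrite ?(map_inj_uniq f_inj) ?enum_uniq // => e.
  rewrite mem_enum; have [h _ hK] := inj_card_bij f_inj (eq_leq (esym cE)).
  by apply/mapP; exists (h e); rewrite ?mem_enum ?hK.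
have labE D : perm_eq [seq lab p | p <- enum (opairs D predT)]
    [seq lab (val e) | e <- enum {: edge D}].
  have -> : [seq lab (val e) | e <- enum {: edge D}] =
      [seq lab p | p <- [seq val e | e <- enum {: edge D}]].
    exact: map_comp.
  exact/perm_map/valE.
apply: perm_trans (labE C) _; rewrite perm_sym; apply: perm_trans (labE C') _.
apply: perm_trans (perm_map _ fE) _.
rewrite (_ : map _ (map f _) = [seq lab (val e) | e <- enum {: edge C}]) ?perm_refl //.
rewrite -[LHS](map_comp (fun e => lab (val e)) f); apply: eq_map => e; exact: fl.
Qed.

Lemma coxeter_labels_perm (C C' : coxsys) (f : edge C -> edge C') (f' : edge C' -> edge C) :
  injective f -> (forall e, lab (val (f e)) = lab (val e)) -> injective f' ->
  perm_eq [seq lab p | p <- enum (opairs C predT)]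
    [seq lab p | p <- enum (opairs C' predT)].
Proof.
move=> f_inj fl f'_inj; apply: (perm_labels_sub f_inj fl).
by apply/eqP; rewrite eqn_leq (leq_card _ f_inj) (leq_card _ f'_inj).
Qed.

Local Close Scope classical_set_scope.
Local Close Scope group_scope.
Local Close Scope ring_scope.

Theorem corollary3 (W : groupType) (S S' : {fset W})
    (m : S -> S -> option nat) (m' : S' -> S' -> option nat)
    (hS : coxeter_system m) (hS' : coxeter_system m')
    (dimS : davis_vinberg_dim S 2) (dimS' : davis_vinberg_dim S' 2) :
  [/\ #|{: S}| = #|{: S'}|,
      #|coxeter_edges m| = #|coxeter_edges m'|
    & edge_labels m = edge_labels m'].
Proof.
pose C := fset_coxsys hS; pose C' := fset_coxsys hS'.
have hd : dim2 C := davis_dim2 dimS; have hd' : dim2 C' := davis_dim2 dimS'.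
have pl : perm_eq [seq lab p | p <- enum (opairs C predT)]
    [seq lab p | p <- enum (opairs C' predT)].
  have [f f_inj fl] := @dihedral_transfer W _ _ _ _ _ _ (edge_family hd) (edge_family hd').
  have [f' f'_inj _] := @dihedral_transfer W _ _ _ _ _ _ (edge_family hd') (edge_family hd).
  exact: coxeter_labels_perm f_inj fl f'_inj.
have cardP (P : pred nat) : #|opairs C P| = #|opairs C' P|.
  by rewrite !card_opairs; apply/permP: P.
split.
(* Points are vertices and even edges; the even and the odd counts agree by [cardP] and cancel. *)
- have := @complex_card W _ _ _ _ _ _ _ _ _ _ _ _ (coxeter_complex hd) (coxeter_complex hd').
  rewrite !card_sum !card_sig (cardP (fun n => ~~ odd n)) (cardP (fun n => odd n)) => /eqP.
  by rewrite eqn_add2r eqn_add2r => /eqP.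
- by rewrite !(card_coxeter_edges hS, card_coxeter_edges hS') cardP.
apply/eq_seq_msetP; apply: perm_trans (perm_edge_labels hS) _.
by apply: perm_trans pl _; rewrite perm_sym; apply: perm_edge_labels.
Qed.
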